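(* Let $\{M(t)\}_{t\ge0}$ be the generalized counting process with rates $\lambda_1,\dots,\lambda_k>0$, $\Lambda=\lambda_1+\cdots+\lambda_k$, and let $\{H(t)\}_{t\ge0}$ be an independent multistable subordinator with stability index $\beta(t)\in(0,1)$. The process $X(t)=M(H(t))$, $t\ge0$, is a non-homogeneous subordinator whose Lévy measure is $$\nu_{t}^{*}(\mathrm{d}x)=\sum_{n=1}^{\infty}\sum_{\Omega(k,n)}\left(\prod_{j=1}^{k}\frac{\lambda_{j}^{x_{j}}}{x_{j}!}\right)\frac{z_{k}!\,(-1)^{z_{k}+1}}{\Lambda^{z_{k}-\beta(t)}}\binom{\beta(t)}{z_{k}}\delta_{n}(\mathrm{d}x),$$ and whose Bernstein function is $$f^{*}(u,t)=\sum_{n=1}^{\infty}\sum_{\Omega(k,n)}\left(\prod_{j=1}^{k}\frac{\lambda_{j}^{x_{j}}}{x_{j}!}\right)\frac{z_{k}!\,(-1)^{z_{k}+1}}{\Lambda^{z_{k}-\beta(t)}}\binom{\beta(t)}{z_{k}}(1-e^{-un}),$$ where $z_k=x_1+\cdots+x_k$ and $\delta_n$ is the Dirac measure at $n$.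
   Context: Generalized counting process (GCP): the Lévy process $\{M(t)\}_{t\ge0}$ with values in the non-negative integers, $M(0)=0$, and $\Pr\{M(t)=n\}=\sum_{\Omega(k,n)}\prod_{j=1}^{k}\frac{(\lambda_{j}t)^{x_{j}}}{x_{j}!}e^{-\Lambda t}$, where $\Omega(k,n)=\{(x_1,\dots,x_k): x_j\in\{0,1,2,\dots\},\ \sum_{j=1}^k jx_j=n\}$. An inhomogeneous (non-homogeneous) subordinator $\{R(t)\}_{t\ge0}$ is a non-decreasing process with $R(0)=0$ and independent increments such that $\mathbb{E}(e^{-u(R(t)-R(s))})=e^{-\int_s^tf(u,\tau)\,\mathrm{d}\tau}$, $0\le s\le t$, where for each $t$ the function $f(u,t)=\int_0^\infty(1-e^{-ux})\,\nu_t(\mathrm{d}x)$ is a Bernstein function in $u$; $\nu_t$ is called its Lévy measure and $f(u,t)$ its Bernstein function. A multistable subordinator $\{H(t)\}_{t\ge0}$ with stability index $\beta(t)\in(0,1)$ ($t\mapsto\beta(t)$ a regular function) is the inhomogeneous subordinator with Lévy measure $\nu_t(\mathrm{d}x)=\frac{\beta(t)x^{-\beta(t)-1}}{\Gamma(1-\beta(t))}\,\mathrm{d}x$, $x>0$, i.e. with Bernstein function $f(u,t)=u^{\beta(t)}$. $\binom{\beta}{z}=\beta(\beta-1)\cdots(\beta-z+1)/z!$. *)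

(* Defs.v *)
From HB Require Import structures.
From mathcomp Require Import all_boot all_order all_algebra.
From mathcomp Require Import all_classical all_reals all_analysis.

Set Implicit Arguments.
Unset Strict Implicit.
Unset Printing Implicit Defensive.

Import Order.TTheory GRing.Theory Num.Theory.
Import numFieldNormedType.Exports.

Local Open Scope classical_set_scope.
Local Open Scope ring_scope.

(* A stochastic process is a function [X : R -> T -> R] on a probability space
   [(T, P)]; only its values at times [0 <= t] are meaningful. *)

Definition mutually_independent (R : realType) (d : measure_display)
    (T : measurableType d) (P : probability T R) (n : nat)
    (Y : 'I_n -> T -> R) : Prop :=
  forall B : 'I_n -> set R, (forall i, measurable (B i)) ->
    P [set w | forall i, B i (Y i w)]
      = (\prod_(i < n) P (Y i @^-1` B i))%E.

Definition process_sigma_algebra (R : realType) (d : measure_display)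
    (T : measurableType d) (X : R -> T -> R) : set (set T) :=
  <<s \bigcup_(t in `[0, +oo[) preimage_set_system [set: T] (X t) measurable >>.

Definition independent_processes (R : realType) (d : measure_display)
    (T : measurableType d) (P : probability T R) (X Y : R -> T -> R) : Prop :=
  forall A B : set T, process_sigma_algebra X A -> process_sigma_algebra Y B ->
    P (A `&` B) = (P A * P B)%E.

Definition independent_increments (R : realType) (d : measure_display)
    (T : measurableType d) (P : probability T R) (X : R -> T -> R) : Prop :=
  forall (n : nat) (t : nat -> R), 0 <= t 0 ->
    (forall i j, (i <= j)%N -> t i <= t j) ->
    mutually_independent P (fun (i : 'I_n) w => X (t i.+1) w - X (t i) w).

Definition stationary_increments (R : realType) (d : measure_display)
    (T : measurableType d) (P : probability T R) (X : R -> T -> R) : Prop :=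
  forall (s t : R) (B : set R), 0 <= s -> s <= t -> measurable B ->
    P [set w | B (X t w - X s w)] = P [set w | B (X (t - s) w - X 0 w)].

Definition stochastically_continuous (R : realType) (d : measure_display)
    (T : measurableType d) (P : probability T R) (X : R -> T -> R) : Prop :=
  forall t e : R, 0 <= t -> 0 < e ->
    P [set w | e < `|X s w - X t w|] @[s --> within `[0, +oo[ (nbhs t)]
      --> 0%E.

Definition cadlag (R : realType) (x : R -> R) : Prop :=
  (forall t : R, 0 <= t -> x s @[s --> t^'+] --> x t) /\
  (forall t : R, 0 < t -> cvg (x s @[s --> t^'-])).

Record levy_process (R : realType) (d : measure_display)
    (T : measurableType d) (P : probability T R) (X : R -> T -> R) : Prop := {
  levy_measurable : forall t : R, 0 <= t -> measurable_fun [set: T] (X t) ;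
  levy_start : {ae P, forall w, X 0 w = 0} ;
  levy_independent : independent_increments P X ;
  levy_stationary : stationary_increments P X ;
  levy_stochastic_continuity : stochastically_continuous P X ;
  levy_cadlag : forall w, cadlag (fun t => X t w) }.

Definition nat_process (R : realType) (T : Type) (M : R -> T -> nat) :
    R -> T -> R :=
  fun t w => (M t w)%:R.

(* The index [j : 'I_k] counts from 0: it stands for jumps of size [j + 1].
   Every solution of [\sum_j (j + 1) x_j = n] has all its entries at most [n],
   so letting [x] range over functions into ['I_n.+1] loses nothing. *)
Definition weight (k n : nat) (x : {ffun 'I_k -> 'I_n.+1}) : nat :=
  (\sum_(j < k) j.+1 * x j)%N.

Definition gcp_pmf (R : realType) (k : nat) (lambda : 'I_k -> R) (t : R)
    (n : nat) : R :=
  \sum_(x : {ffun 'I_k -> 'I_n.+1} | weight x == n)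
    (\prod_(j < k) ((lambda j * t) ^+ x j / (x j)`!%:R))
      * expR (- (\sum_(j < k) lambda j) * t).

Definition generalized_counting_process (R : realType) (d : measure_display)
    (T : measurableType d) (P : probability T R) (k : nat)
    (lambda : 'I_k -> R) (M : R -> T -> nat) : Prop :=
  levy_process P (nat_process M) /\
  forall (t : R) n, 0 <= t -> P [set w | M t w = n] = (gcp_pmf lambda t n)%:E.

Definition bernstein_function (R : realType) (g : R -> R) : Prop :=
  (forall u : R, 0 < u -> 0 <= g u) /\
  (forall n (u : R), 0 < u ->
    derivable (g^`(n))%classic u 1 /\ 0 <= (-1) ^+ n * (g^`(n.+1))%classic u).

(* A measure on ]0, +oo[, seen as a measure on the line. *)
Definition subordinator_levy_measure (R : realType)
    (nu : {measure set R -> \bar R}) : Prop :=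
  nu (~` `]0, +oo[) = 0%E /\
  (\int[nu]_(x in `]0%R, +oo[) (Num.min 1 x)%:E < +oo)%E.

(* The state space is [0, +oo[ (hence [subord_ge0] for every outcome), while the
   initial value and monotonicity are almost sure.  The real-valued integral in
   [subord_laplace] is [fine] of the extended one, which is meaningful thanks
   to [subord_locally_integrable]. *)
Record inhomogeneous_subordinator (R : realType) (d : measure_display)
    (T : measurableType d) (P : probability T R) (X : R -> T -> R)
    (nu : R -> {measure set R -> \bar R}) (f : R -> R -> R) : Prop := {
  subord_measurable : forall t : R, 0 <= t -> measurable_fun [set: T] (X t) ;
  subord_ge0 : forall (t : R) w, 0 <= t -> 0 <= X t w ;
  subord_start : {ae P, forall w, X 0 w = 0} ;
  subord_nondecreasing :
    {ae P, forall w, forall s t : R, 0 <= s -> s <= t -> X s w <= X t w} ;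
  subord_independent : independent_increments P X ;
  subord_levy_measure : forall t : R, 0 <= t -> subordinator_levy_measure (nu t) ;
  subord_bernstein : forall t : R, 0 <= t -> bernstein_function (f ^~ t) ;
  subord_levy_khintchine : forall u t : R, 0 <= u -> 0 <= t ->
    (f u t)%:E = (\int[nu t]_(x in `]0%R, +oo[) (1 - expR (- u * x))%:E)%E ;
  subord_locally_integrable : forall u t : R, 0 <= u -> 0 <= t ->
    lebesgue_measure.-integrable `[0, t] (fun tau => (f u tau)%:E) ;
  subord_laplace : forall u s t : R, 0 <= u -> 0 <= s -> s <= t ->
    ('E_P[fun w => expR (- u * (X t w - X s w))%R])%E
      = (expR (- \int[lebesgue_measure]_(tau in `[s, t]) f u tau))%:E }.

Definition Gamma (R : realType) (a : R) : R :=
  \int[lebesgue_measure]_(x in `]0, +oo[) (x `^ (a - 1) * expR (- x)).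

Definition stable_levy_density (R : realType) (b x : R) : R :=
  b * x `^ (- b - 1) / Gamma (1 - b).

(* Borel measurability is the least regularity of [beta] under which the time
   integrals of [u `^ beta t] make sense. *)
Definition multistable_subordinator (R : realType) (d : measure_display)
    (T : measurableType d) (P : probability T R) (beta : R -> R)
    (H : R -> T -> R) : Prop :=
  [/\ forall t : R, 0 <= t -> 0 < beta t < 1,
      measurable_fun (`[0, +oo[ : set R) beta
    & exists nu : R -> {measure set R -> \bar R},
        (forall (t : R) (A : set R), 0 <= t -> measurable A ->
          nu t A = (\int[lebesgue_measure]_(x in A `&` `]0%R, +oo[)
                      (stable_levy_density (beta t) x)%:E)%E) /\
        inhomogeneous_subordinator P H nu (fun u t => u `^ beta t)].

Definition subordinated (R : realType) (T : Type) (M : R -> T -> nat)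
    (H : R -> T -> R) : R -> T -> nat :=
  fun t w => M (H t w) w.

Definition gbinom (R : realType) (b : R) (z : nat) : R :=
  (\prod_(i < z) (b - i%:R)) / z`!%:R.

(* The mass which the Lévy measure of [M (H t)] gives to the point [n], for
   the stability index [b]. *)
Definition jump_mass (R : realType) (k : nat) (lambda : 'I_k -> R) (b : R)
    (n : nat) : R :=
  let Lambda := \sum_(j < k) lambda j in
  \sum_(x : {ffun 'I_k -> 'I_n.+1} | weight x == n)
    let z := (\sum_(j < k) x j)%N in
    (\prod_(j < k) (lambda j ^+ x j / (x j)`!%:R))
      * (z`!%:R * (-1) ^+ z.+1 / Lambda `^ (z%:R - b)) * gbinom b z.

(* Main.v *)
Require Import Defs.
From HB Require Import structures.
From mathcomp Require Import all_boot all_order all_algebra.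
From mathcomp Require Import all_classical all_reals all_analysis.
From mathcomp Require Import measurable_realfun.
From mathcomp Require Import ring lra.

Set Implicit Arguments.
Unset Strict Implicit.
Unset Printing Implicit Defensive.

Import Order.TTheory GRing.Theory Num.Theory.
Import numFieldNormedType.Exports.

Local Open Scope classical_set_scope.
Local Open Scope ring_scope.

(** Write [phi u = \sum_j lambda_j (1 - exp (- u j))] for the Laplace exponent
    of the counting process, the jump sizes [j] being counted from 1 here, so
    that [E exp (- u M(t)) = exp (- t * phi u)].  Conditioning on the independent
    clock [H] gives, for [s <= t],

      [E exp (- u (M(H t) - M(H s))) = E exp (- phi u * (H t - H s))
         = exp (- \int_s^t (phi u) ^ beta(tau) dtau)],

    so the Bernstein function of the time-changed process can only be
    [f u t = (phi u) ^ beta(t)], and it remains to recognise this power in the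
    announced series.

    Series.  Let [G = \sum_j lambda_j X^j], so that [phi u = Lambda - G(r)] with
    [r = exp (- u)].  The multinomial theorem, read off the coefficient of [X^n]
    in [G^z], turns a sum over the solutions of [\sum_j j x_j = n] weighted by
    [\prod_j lambda_j^(x_j) / x_j! * z! * a_z], where [z = \sum_j x_j], into
    [\sum_z a_z [X^n] G^z] ([sum_weight_eq]).  Summing against [r^n] and exchanging the two non-negative
    sums gives [\sum_z a_z G(r)^z] ([nneseries_compound]).  With
    [a_z = h^z / z! * exp (- Lambda h)] this is the generating function of
    [M(h)]; with the binomial coefficients of [(1 - y) ^ b] it shows that the
    masses of the Lévy measure satisfy
    [\sum_n q_n r^n = Lambda ^ b - (phi u) ^ b] ([jump_mass_generating]).  The
    case [r = 1] needs the binomial series at the end of its interval of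
    convergence, where it still converges because [b > 0]; it yields the
    total mass [Lambda ^ b], hence finiteness of the measure, and by
    difference [\sum_n q_n (1 - exp (- u n)) = (phi u) ^ b].

    Probability.  Since [M] is right-continuous, [(h, w) |-> M(h)(w)] is jointly
    measurable.  Independence of [M] and [H] says that the law of the pair of
    processes is a product measure, so by Fubini the two processes can be
    evaluated at two independent outcomes ([integral_time_change]).  Freezing
    the clock, the independent and stationary increments of [M] give the
    conditional probability [\prod_i p_i (H(t_(i+1)) - H(t_i))] of a joint
    event on the increments, where [p_i h] is the probability that [M(h) - M(0)]
    falls in the [i]-th set; the independent increments of [H] then factor the
    mean of this product ([integral_prod_independent]). *)

(** * The multinomial theorem on the coefficients of a polynomial *)

(** The exponential series turns a sum into a product; truncating each series
    at degree [N] does not affect the coefficients of degree at most [N].  The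
    elements [c i] stand for [1 / i!], which makes sense in rings such as
    [{poly R}] without a division. *)
Lemma prod_truncated_exp (A : comNzRingType) (c : nat -> A)
    (cK : forall i, c i * i`!%:R = 1) (I : Type)
    (s : seq I) (g : I -> A) (N z : nat) : (z <= N)%N ->
  (\prod_(j <- s) \sum_(i < N.+1) (c i * g j ^+ i) *: 'X^i : {poly A})`_z
  = c z * (\sum_(j <- s) g j) ^+ z.
Proof.
elim: s z => [|j s IH] z zN.
  rewrite !big_nil coef1 expr0n; case: z {zN} => [|z] /=.
    by move: (cK 0%N); rewrite fact0 !mulr1 => ->.
  by rewrite mulr0.
rewrite !big_cons coefM addrC exprDn mulr_sumr; apply: eq_bigr => i _.
have iz : (i <= z)%N by rewrite -ltnS.
rewrite IH; last by rewrite (leq_trans (leq_subr _ _)).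
have -> : (\sum_(l < N.+1) (c l * g j ^+ l) *: 'X^l : {poly A})`_i
   = c i * g j ^+ i.
  have iN : (i < N.+1)%N by rewrite ltnS (leq_trans iz).
  rewrite coef_sum (bigD1 (Ordinal iN)) //= coefZ coefXn eqxx mulr1.
  rewrite big1 ?addr0 // => l; rewrite -val_eqE /= => lNi.
  by rewrite coefZ coefXn eq_sym (negbTE lNi) mulr0.
(* Multiply the left-hand side by [c z * z`! = 1] and write
   [z`! = 'C(z, i) * (i`! * (z - i)`!)]: the last two factorials cancel against
   [c i] and [c (z - i)]. *)
have -> : c i * g j ^+ i * (c (z - i)%N * (\sum_(j0 <- s) g j0) ^+ (z - i))
  = c z * z`!%:R * (c i * g j ^+ i *
      (c (z - i)%N * (\sum_(j0 <- s) g j0) ^+ (z - i))).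
  by rewrite cK mul1r.
rewrite -(bin_fact iz) !natrM -mulr_natr.
transitivity (c z * 'C(z, i)%:R * (c i * i`!%:R) *
  (c (z - i)%N * (z - i)`!%:R) * (g j ^+ i * (\sum_(j0 <- s) g j0) ^+ (z - i))).
  by ring.
by rewrite !cK; ring.
Qed.

Lemma multinomial_expansion (A : comNzRingType) (c : nat -> A)
    (cK : forall i, c i * i`!%:R = 1) (k : nat)
    (g : 'I_k -> A) (N z : nat) : (z <= N)%N ->
  \sum_(x : {ffun 'I_k -> 'I_N.+1} | (\sum_(j < k) x j)%N == z)
     \prod_(j < k) (c (x j) * g j ^+ x j)
  = c z * (\sum_(j < k) g j) ^+ z.
Proof.
move=> zN; rewrite -(prod_truncated_exp cK _ _ zN) bigA_distr_bigA coef_sum.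
rewrite big_mkcond /=; apply: eq_bigr => x _.
have -> : (\prod_(j < k) ((c (x j) * g j ^+ x j) *: 'X^(x j)) : {poly A})
   = (\prod_(j < k) (c (x j) * g j ^+ x j)) *: 'X^(\sum_(j < k) x j).
  elim/big_rec3: _ => [|j p n q _ ->]; first by rewrite expr0 scale1r.
  by rewrite exprD -scalerAl -scalerAr scalerA.
by rewrite coefZ coefXn eq_sym; case: eqP; rewrite ?mulr1 ?mulr0.
Qed.

(** The generating polynomial of the jump rates: jumps of size [j + 1] occur at
    the rate [lambda j]. *)
Definition jump_polynomial (R : realType) (k : nat) (lambda : 'I_k -> R) :
    {poly R} :=
  \sum_(j < k) (lambda j)%:P * 'X^(j.+1).

Section compound.
Context (R : realType) (k : nat) (lambda : 'I_k -> R).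
Let G := jump_polynomial lambda.

(** The multinomial theorem in [{poly R}], one coefficient at a time: the
    monomial attached to [x] has degree [weight x]. *)
Lemma coef_jump_polynomialX (n z : nat) : (z <= n)%N ->
  \sum_(x : {ffun 'I_k -> 'I_n.+1} |
      (weight x == n) && ((\sum_(j < k) x j)%N == z))
     (\prod_(j < k) (lambda j ^+ x j / (x j)`!%:R)) * z`!%:R
  = (G ^+ z)`_n.
Proof.
move=> zn.
have f0 i : i`!%:R != 0 :> R by rewrite pnatr_eq0 -lt0n fact_gt0.
have cK i : (i`!%:R^-1)%:P * i`!%:R = 1 :> {poly R}.
  by rewrite -polyC_natr -polyCM mulVf.
have /(congr1 (fun p : {poly R} => z`!%:R * p`_n)) :=
  multinomial_expansion cK (fun j => (lambda j)%:P * 'X^(j.+1)) zn.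
rewrite coefCM mulVKf // => <-; rewrite coef_sum mulr_sumr.
rewrite big_mkcond [RHS]big_mkcond /=; apply: eq_bigr => x _.
have -> : \prod_(j < k) (((x j)`!%:R^-1)%:P * ((lambda j)%:P * 'X^(j.+1)) ^+ x j)
   = (\prod_(j < k) (lambda j ^+ x j / (x j)`!%:R))%:P * 'X^(weight x).
  rewrite /weight; elim/big_rec3: _ => [|j p q r _ ->].
    by rewrite expr0 mulr1.
  rewrite exprD exprMn -exprM !polyCM -polyC_exp; ring.
rewrite coefCM coefXn eq_sym.
by case: eqP => _; case: eqP => _ //=; rewrite ?mulr1 ?mulr0 ?mul0r // mulrC.
Qed.

(** Grouping the solutions [x] of [weight x = n] by their total number of jumps
    [z]; there are at most [n] of them, as every jump has size at least 1. *)
Lemma sum_weight_eq (n : nat) (a : nat -> R) :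
  \sum_(x : {ffun 'I_k -> 'I_n.+1} | weight x == n)
     (\prod_(j < k) (lambda j ^+ x j / (x j)`!%:R))
       * ((\sum_(j < k) x j)`!%:R * a (\sum_(j < k) x j)%N)
  = \sum_(z < n.+1) a z * (G ^+ z)`_n.
Proof.
have wz (x : {ffun 'I_k -> 'I_n.+1}) : weight x == n ->
    (\sum_(j < k) x j < n.+1)%N.
  move=> /eqP wx; rewrite ltnS -[leqRHS]wx /weight.
  by apply: leq_sum => j _; rewrite leq_pmull.
rewrite (partition_big (fun x : {ffun 'I_k -> 'I_n.+1} =>
  inord (\sum_(j < k) x j) : 'I_n.+1) xpredT) //=.
apply: eq_bigr => z _; have zn : (z <= n)%N by rewrite -ltnS.
rewrite -coef_jump_polynomialX // mulr_sumr.
apply: eq_big => [x|x /andP[wx /eqP <-]].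
  case: (boolP (weight x == n)) => //= wx.
  by rewrite -val_eqE /= inordK // wz.
by rewrite inordK ?wz //; ring.
Qed.

End compound.

(** * Power series and the binomial series *)

(** A form of `radius of convergence at least 1' that is visibly stable under
    multiplication of the coefficients by [n]. *)
Definition subexponential (R : realType) (a : nat -> R) : Prop :=
  forall r : R, 0 < r -> r < 1 -> exists C, forall n, `|a n| * r ^+ n <= C.

Lemma subexponential_bounded (R : realType) (a : nat -> R) (C : R) :
  (forall n, `|a n| <= C) -> subexponential a.
Proof.
move=> aC r r0 r1; exists C => n; apply: le_trans (aC n).
by rewrite ler_piMr // exprn_ile1 // ltW.
Qed.

Lemma bernoulli_le (R : realType) (h : R) (n : nat) : 0 <= h ->
  n%:R * h <= (1 + h) ^+ n.
Proof.
move=> h0; suff : 1 + n%:R * h <= (1 + h) ^+ n by lra.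
elim: n => [|n IH]; first by rewrite mul0r addr0 expr0.
rewrite exprS -natr1.
have : 0 <= n%:R * h by rewrite mulr_ge0.
nra.
Qed.

(** For [r < K < 1] one has [n * h <= (K / r) ^ n] with [h = K / r - 1], so the
    factor [n] is absorbed by passing from the radius [r] to the radius [K]. *)
Lemma subexponentialM (R : realType) (a : nat -> R) :
  subexponential a -> subexponential (fun n => n%:R * a n).
Proof.
move=> sa r r0 r1; set K := (1 + r) / 2.
have K0 : 0 < K by rewrite /K; lra.
have K1 : K < 1 by rewrite /K; lra.
have rK : r < K by rewrite /K; lra.
have [C aC] := sa _ K0 K1.
set h := K / r - 1.
have h0 : 0 < h by rewrite /h subr_gt0 ltr_pdivlMr ?mul1r.
exists (C / h) => n; rewrite ler_pdivlMr //; apply: le_trans (aC n).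
have -> : K = (1 + h) * r by rewrite /h; field; rewrite gt_eqF.
rewrite exprMn normrM (ger0_norm (ler0n _ n)).
have := bernoulli_le n (ltW h0).
set b := (1 + h) ^+ n => nhb.
have ar0 : 0 <= `|a n| * r ^+ n by rewrite mulr_ge0 // exprn_ge0 // ltW.
have -> : n%:R * `|a n| * r ^+ n * h = (n%:R * h) * (`|a n| * r ^+ n) by ring.
have -> : `|a n| * (b * r ^+ n) = b * (`|a n| * r ^+ n) by ring.
exact: ler_wpM2r.
Qed.

Lemma subexponential_diffs (R : realType) (a : nat -> R) :
  subexponential a -> subexponential (pseries_diffs a).
Proof.
move=> /subexponentialM sa r r0 r1; have [C aC] := sa r r0 r1.
exists (C / r) => n; rewrite ler_pdivlMr // /pseries_diffs -mulrA -exprSr.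
exact: aC.
Qed.

Lemma cvg_pseries_subexponential (R : realType) (a : nat -> R) (x : R) :
  subexponential a -> `|x| < 1 -> cvgn (pseries a x).
Proof.
move=> sa x1; set r := (1 + `|x|) / 2.
have x0 : 0 <= `|x| by [].
have r0 : 0 < r by rewrite /r; lra.
have r1 : r < 1 by rewrite /r; lra.
have [C aC] := sa _ r0 r1.
apply: normed_cvg.
apply: (@series_le_cvg _ _ (geometric C (`|x| / r))).
- by move=> n /=.
- move=> n /=; rewrite mulr_ge0 ?exprn_ge0 ?divr_ge0 // ?(ltW r0) //.
  by apply: le_trans (aC 0%N); rewrite expr0 mulr1.
- move=> n /=; rewrite normrM normrX expr_div_n mulrA ler_pdivlMr ?exprn_gt0 //.
  have := aC n; have : 0 <= `|x| ^+ n by rewrite exprn_ge0.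
  by move=> x2 aCn; rewrite mulrAC ler_wpM2r.
- apply: is_cvg_geometric_series; rewrite ger0_norm ?divr_ge0 // ?(ltW r0) //.
  by rewrite ltr_pdivrMr // mul1r /r; lra.
Qed.

Lemma is_derive_pseries (R : realType) (a : nat -> R) (x : R) :
  subexponential a -> `|x| < 1 ->
  is_derive x 1 (fun y => limn (pseries a y)) (limn (pseries (pseries_diffs a) x)).
Proof.
move=> sa x1; have x0 : 0 <= `|x| by [].
have K1 : `|(1 + `|x|) / 2| < 1 by rewrite ger0_norm; lra.
have sda := subexponential_diffs sa.
apply: (@pseries_snd_diffs _ _ ((1 + `|x|) / 2)).
- exact: cvg_pseries_subexponential.
- exact: cvg_pseries_subexponential.
- by apply: cvg_pseries_subexponential => //; exact: subexponential_diffs.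
- rewrite [ltRHS]ger0_norm; lra.
Qed.

Lemma mul_lim_pseries_diffs (R : realType) (a : nat -> R) (x : R) :
  subexponential a -> `|x| < 1 ->
  x * limn (pseries (pseries_diffs a) x)
  = limn (pseries (fun n => n%:R * a n) x).
Proof.
move=> sa x1; apply/esym/cvg_lim => //.
have sda := cvg_pseries_subexponential (subexponential_diffs sa) x1.
have -> : pseries (fun n => n%:R * a n) x
    = (fun n => x * series (fun i => i%:R * a i * x ^+ i.-1) n).
  apply/funext => n; rewrite /pseries /series /= mulr_sumr.
  apply: eq_bigr => -[|i] _; first by rewrite !mul0r mulr0.
  by rewrite /= exprS; ring.
exact: (cvgM (cvg_cst x) (pseries_diffs_equiv sda)).
Qed.

(** The coefficient of [y ^ z] in the expansion of [(1 - y) ^ b]. *)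
Definition alt_binomial (R : realType) (b : R) (z : nat) : R :=
  (-1) ^+ z * gbinom b z.

Lemma alt_binomial0 (R : realType) (b : R) : alt_binomial b 0 = 1.
Proof. by rewrite /alt_binomial /gbinom big_ord0 expr0 fact0 divr1 mul1r. Qed.

(** This recurrence is the differential equation [(1 - y) p' = - b p] read on
    the coefficients. *)
Lemma alt_binomialS (R : realType) (b : R) (z : nat) :
  z.+1%:R * alt_binomial b z.+1 = (z%:R - b) * alt_binomial b z.
Proof.
rewrite /alt_binomial /gbinom big_ord_recr /= factS natrM exprS.
have f0 : z`!%:R != 0 :> R by rewrite pnatr_eq0 -lt0n fact_gt0.
by field; rewrite f0 nat1r pnatr_eq0.
Qed.

Section alt_binomial.
Context (R : realType) (b : R).
Hypothesis b01 : 0 < b < 1.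

Lemma alt_binomial_le0 (z : nat) : alt_binomial b z.+1 <= 0.
Proof.
have /andP[b0 b1] := b01; elim: z => [|z IH].
  have := alt_binomialS b 0; rewrite alt_binomial0; lra.
have := alt_binomialS b z.+1.
have z0 : 0 < z.+2%:R :> R by [].
rewrite -(pmulr_rle0 _ z0) => ->; apply: mulr_ge0_le0 => //.
by rewrite subr_ge0 (le_trans (ltW b1)) // ler1n.
Qed.

Lemma norm_alt_binomial_le1 (z : nat) : `|alt_binomial b z| <= 1.
Proof.
have /andP[b0 b1] := b01; elim: z => [|z IH].
  by rewrite alt_binomial0 normr1.
have z0 : 0 < z.+1%:R :> R by [].
have /(congr1 (fun x : R => `|x|)) := alt_binomialS b z.
rewrite (normrM _ (alt_binomial b z.+1)) (normrM _ (alt_binomial b z)).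
rewrite (gtr0_norm z0) => E.
rewrite -(ler_pM2l z0) E mulr1 -[leRHS]mulr1.
apply: ler_pM => //.
rewrite -natr1 ler_norml; have : 0 <= z%:R :> R by [].
by move=> z'0; apply/andP; split; lra.
Qed.

(** The partial sums at [y = 1] telescope:
    [b * \sum_(z <= N) c_z = - (N + 1) * c_(N + 1)], and all coefficients but
    the first are non-positive. *)
Lemma sum_alt_binomial_ge0 (N : nat) : 0 <= \sum_(z < N.+1) alt_binomial b z.
Proof.
have /andP[b0 b1] := b01.
suff E : b * \sum_(z < N.+1) alt_binomial b z = - (N.+1%:R * alt_binomial b N.+1).
  rewrite -(pmulr_rge0 _ b0) E oppr_ge0.
  by apply: mulr_ge0_le0 => //; exact: alt_binomial_le0.
elim: N => [|N IH].
  by rewrite big_ord1 alt_binomialS; ring.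
rewrite big_ord_recr /= mulrDr IH (alt_binomialS b N.+1); ring.
Qed.

(** The sum [p] of the series solves [(1 - y) p' = - b p], so that
    [p y * (1 - y) ^ (- b)] has derivative zero, and it is 1 at [y = 0]. *)
Lemma lim_alt_binomial (y : R) : 0 <= y -> y < 1 ->
  limn (pseries (alt_binomial b) y) = (1 - y) `^ b.
Proof.
have sa : subexponential (alt_binomial b).
  exact: subexponential_bounded norm_alt_binomial_le1.
set p : R -> R := fun y => limn (pseries (alt_binomial b) y).
set dp : R -> R := fun y => limn (pseries (pseries_diffs (alt_binomial b)) y).
have ode (x : R) : `|x| < 1 -> (1 - x) * dp x = - b * p x.
  move=> x1; rewrite mulrBl mul1r {2}/dp mul_lim_pseries_diffs //.
  have c1 := cvg_pseries_subexponential (subexponential_diffs sa) x1.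
  have c2 := cvg_pseries_subexponential (subexponentialM sa) x1.
  have c3 := cvg_pseries_subexponential sa x1.
  transitivity (limn (pseries (pseries_diffs (alt_binomial b)) x
     \- pseries (fun n => n%:R * alt_binomial b n) x)).
    by apply/esym/cvg_lim => //; exact: cvgB.
  apply/cvg_lim => //.
  have -> : pseries (pseries_diffs (alt_binomial b)) x
     \- pseries (fun n => n%:R * alt_binomial b n) x
     = (fun n => - b * pseries (alt_binomial b) x n).
    apply/funext => n; rewrite /pseries /series /= mulr_sumr -sumrB.
    by apply: eq_bigr => i _; rewrite /pseries_diffs alt_binomialS; ring.
  exact: (cvgM (cvg_cst (- b)) c3).
have dh (x : R) : `|x| < 1 ->
    is_derive x 1 (fun y : R => p y * (1 - y) `^ (- b)) 0.
  move=> x1; have x1' : 0 < 1 - x by have := ler_norm x; lra.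
  have d1 : is_derive x 1 p (dp x) by exact: is_derive_pseries.
  have d2 := is_derive1_powR (- b) x1'.
  have d3 : is_derive x 1 (fun y : R => 1 - y) (- 1).
    by apply: is_derive_eq; rewrite add0r mul1r.
  have d4 := @is_derive1_comp _ (fun z : R => z `^ (- b))
    (fun y : R => 1 - y) _ _ _ d2 d3.
  have d5 := is_deriveM d1 d4.
  suff : is_derive x 1 (p * ((fun z : R => z `^ (- b)) \o (fun y : R => 1 - y))) 0.
    by [].
  apply: is_derive_eq.
  have x10 : 1 - x != 0 by rewrite gt_eqF.
  have -> : (1 - x) `^ (- b - 1) = (1 - x) `^ (- b) / (1 - x).
    by rewrite powRB ?powRr1 ?(ltW x1') // x10 implybT.
  have -> : dp x = - b * p x / (1 - x) by rewrite -(ode _ x1) mulrAC mulfV ?mul1r.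
  by rewrite /GRing.scale /=; field.
move=> y0 y1; have p0 : p 0 = 1.
  apply/cvg_lim => //.
  rewrite -(cvg_shiftn 1); apply: cvg_near_cst; near=> n.
  rewrite /pseries /series /= addn1 big_nat_recl //= expr0 mulr1 alt_binomial0.
  by rewrite big1 ?addr0 // => i _; rewrite expr0n mulr0.
have [<-|yn0] := eqVneq 0 y; first by rewrite subr0 powR1.
have y_gt0 : 0 < y by rewrite lt_neqAle yn0.
have [||c _] := @MVT _ (fun y => p y * (1 - y) `^ (- b)) (fun=> 0) 0 y y_gt0.
- move=> x; rewrite in_itv /= => /andP[x0 xy]; apply: dh.
  by rewrite ger0_norm ?(ltW x0) // (lt_trans xy).
- apply: derivable_within_continuous => x.
  rewrite in_itv /= => /andP[x0 xy]; have [] // := dh x.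
  by rewrite ger0_norm // (le_lt_trans xy).
rewrite mul0r => /subr0_eq; rewrite subr0 powR1 mulr1 p0 => E.
have y10 : 1 - y != 0 by rewrite subr_eq0 eq_sym lt_eqF.
rewrite -[LHS]/(p y) -[LHS]mulr1 -[X in _ * X = _](@mulVf _ ((1 - y) `^ b)).
  by rewrite -powRN mulrA E mul1r.
by apply/lt0r_neq0/powR_gt0; rewrite subr_gt0.
Unshelve. all: by end_near. Qed.

(** The non-negative coefficients of [1 - (1 - y) ^ b]. *)
Definition binomial_weight (z : nat) : R :=
  if z is 0 then 0 else - alt_binomial b z.

Lemma binomial_weight_ge0 z : 0 <= binomial_weight z.
Proof. by case: z => //= z; rewrite oppr_ge0 alt_binomial_le0. Qed.

Lemma sum_binomial_weight_le1 N : \sum_(0 <= z < N) binomial_weight z <= 1.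
Proof.
case: N => [|N]; first by rewrite big_nil.
have := sum_alt_binomial_ge0 N; rewrite big_mkord !big_ord_recl alt_binomial0.
by rewrite /= sumrN add0r; lra.
Qed.

Lemma cvg_binomial_weight (y : R) : 0 <= y -> y < 1 ->
  series (fun z => binomial_weight z * y ^+ z) @ \oo --> 1 - (1 - y) `^ b.
Proof.
move=> y0 y1; rewrite -lim_alt_binomial //.
have sa : subexponential (alt_binomial b).
  exact: subexponential_bounded norm_alt_binomial_le1.
have y1' : `|y| < 1 by rewrite ger0_norm.
have c1 := cvg_pseries_subexponential sa y1'.
apply: cvg_trans (cvgB (cvg_cst (1 : R)) c1); apply: near_eq_cvg.
near=> n; have n0 : (0 < n)%N by near: n; exact: nbhs_infty_gt.
rewrite -(prednK n0); move: n.-1 => m; rewrite /pseries /series /= !fctE /= !big_mkord.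
rewrite !big_ord_recl /= expr0 mul0r add0r alt_binomial0 mulr1 opprD addrA.
by rewrite subrr add0r -sumrN; apply: eq_bigr => i _ /=; rewrite mulNr.
Unshelve. all: by end_near. Qed.

(** At the end point [y = 1] the partial sums are at most 1 by telescoping, and
    the sum is at least [1 - (1 - x) ^ b] for every [x < 1] by monotonicity. *)
Lemma nneseries_binomial_weight (y : R) : 0 <= y -> y <= 1 ->
  (\sum_(0 <= z <oo) (binomial_weight z * y ^+ z)%:E = (1 - (1 - y) `^ b)%:E)%E.
Proof.
have /andP[b0 b1] := b01.
have term_ge0 (x : R) z : 0 <= x -> (0 <= (binomial_weight z * x ^+ z)%:E)%E.
  by move=> x0; rewrite lee_fin mulr_ge0 ?binomial_weight_ge0 ?exprn_ge0.
have interior (x : R) : 0 <= x -> x < 1 ->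
    (\sum_(0 <= z <oo) (binomial_weight z * x ^+ z)%:E
      = (1 - (1 - x) `^ b)%:E)%E.
  move=> x0 x1; have c := cvg_binomial_weight x0 x1.
  rewrite -(cvg_lim _ c) // -EFin_lim; last by apply/cvg_ex; eexists; exact: c.
  by congr (limn _); apply/funext => n; rewrite /series /= -sumEFin.
move=> y0; rewrite le_eqVlt => /orP[/eqP -> {y y0}|]; last exact: interior.
rewrite subrr powR0 ?gt_eqF // subr0; apply/eqP; rewrite eq_le; apply/andP; split.
  apply: lime_le; first by apply: is_cvg_nneseries => n _ _; exact: term_ge0.
  near=> n; rewrite sumEFin lee_fin.
  under eq_bigr do rewrite expr1n mulr1.
  exact: sum_binomial_weight_le1.
apply/lee_subgt0Pr => e e0.
(* [x = 1 - min(e, 1) ^ (1 / b)] makes [(1 - x) ^ b = min(e, 1)]. *)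
pose m := Num.min e 1; have m0 : 0 < m by rewrite /m lt_min e0 ltr01.
have m1 : m <= 1 by rewrite /m ge_min lexx orbT.
pose x := 1 - m `^ b^-1.
have mb : (1 - x) `^ b = m.
  rewrite /x opprB addrC subrK -powRrM mulVf ?gt_eqF // powRr1 ?ltW //.
have x0 : 0 <= x.
  have : m `^ b^-1 <= 1 `^ b^-1.
    by apply: ge0_ler_powR; rewrite ?nnegrE ?invr_ge0 // ltW.
  by rewrite powR1 /x subr_ge0.
have x1 : x < 1 by rewrite /x ltrBlDr ltrDl powR_gt0.
apply: (@le_trans _ _ (1 - (1 - x) `^ b)%:E).
  by rewrite mb EFinB leeB // lee_fin /m ge_min lexx.
rewrite -(interior _ x0 x1); apply: lee_nneseries => [z _ _|z _].
  exact: term_ge0.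
rewrite lee_fin; apply: ler_wpM2l; first exact: binomial_weight_ge0.
by rewrite expr1n exprn_ile1 // ltW.
Unshelve. all: by end_near. Qed.
End alt_binomial.

(** * Generating functions of the counting process and of the jump masses *)

Lemma nneseries_fin_support (R : realType) (u : nat -> R) (N : nat) :
  (forall n, 0 <= u n) -> (forall n, (N <= n)%N -> u n = 0) ->
  (\sum_(0 <= n <oo) (u n)%:E = (\sum_(n < N) u n)%:E)%E.
Proof.
move=> u0 uN; rewrite (nneseries_split 0 N) => [|n _]; last by rewrite lee_fin.
rewrite add0n eseries0 ?adde0 => [|n Nn _]; last by rewrite uN.
by rewrite sumEFin big_mkord.
Qed.

Section compound_series.
Context (R : realType) (k : nat) (lambda : 'I_k -> R).
Hypothesis lambda_gt0 : forall j, 0 < lambda j.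
Let G := jump_polynomial lambda.
Let Lambda := \sum_(j < k) lambda j.

Lemma horner_jump_polynomial (r : R) :
  G.[r] = \sum_(j < k) lambda j * r ^+ j.+1.
Proof.
rewrite /G /jump_polynomial horner_sum; apply: eq_bigr => j _.
by rewrite hornerM hornerC hornerXn.
Qed.

Lemma horner_jump_polynomial1 : G.[1] = Lambda.
Proof.
by rewrite horner_jump_polynomial; apply: eq_bigr => j _; rewrite expr1n mulr1.
Qed.

Lemma jump_polynomial_ge0 (r : R) : 0 <= r -> 0 <= G.[r].
Proof.
move=> r0; rewrite horner_jump_polynomial; apply: sumr_ge0 => j _.
by rewrite mulr_ge0 ?exprn_ge0 // ltW.
Qed.

Lemma jump_polynomial_le (r : R) : 0 <= r -> r <= 1 -> G.[r] <= Lambda.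
Proof.
move=> r0 r1; rewrite horner_jump_polynomial; apply: ler_sum => j _.
by rewrite ler_piMr ?exprn_ile1 // ltW.
Qed.

Lemma coef_jump_polynomialX_ge0 (n z : nat) : 0 <= (G ^+ z)`_n.
Proof.
elim: z n => [|z IH] n; first by rewrite expr0 coef1 ler0n.
rewrite exprS coefM; apply: sumr_ge0 => i _; apply: mulr_ge0 => //.
rewrite coef_sum; apply: sumr_ge0 => j _.
by rewrite coefCM coefXn mulr_ge0 ?ler0n // ltW.
Qed.

Lemma coef_jump_polynomialX_eq0 (n z : nat) : (n < z)%N -> (G ^+ z)`_n = 0.
Proof.
move=> nz; have -> : G = (\sum_(j < k) (lambda j)%:P * 'X^j) * 'X.
  rewrite mulr_suml; apply: eq_bigr => j _.
  by rewrite -mulrA -exprSr.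
by rewrite exprMn coefMXn nz.
Qed.

(** Both sides are the double series of [a z * [X^n] G^z * r ^ n], whose terms
    are non-negative: the sum over [z] is finite for each [n] because [X]
    divides [G], and the sum over [n] is finite for each [z]. *)
Lemma nneseries_compound (a : nat -> R) (r : R) : (forall z, 0 <= a z) ->
  0 <= r ->
  (\sum_(0 <= n <oo) ((\sum_(z < n.+1) a z * (G ^+ z)`_n) * r ^+ n)%:E
   = \sum_(0 <= z <oo) (a z * G.[r] ^+ z)%:E)%E.
Proof.
move=> a0 r0.
have t0 n z : 0 <= a z * (G ^+ z)`_n * r ^+ n.
  by rewrite !mulr_ge0 ?exprn_ge0 ?coef_jump_polynomialX_ge0.
transitivity (\sum_(0 <= n <oo) \sum_(0 <= z <oo)
    (a z * (G ^+ z)`_n * r ^+ n)%:E)%E.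
  apply: eq_eseriesr => n _; rewrite mulr_suml.
  rewrite (@nneseries_fin_support _ (fun z => a z * (G ^+ z)`_n * r ^+ n) n.+1) //.
  by move=> z nz; rewrite coef_jump_polynomialX_eq0 // mulr0 mul0r.
rewrite (@nneseries_interchange _ (fun n z => (a z * (G ^+ z)`_n * r ^+ n)%:E)).
  apply: eq_eseriesr => z _; rewrite -horner_exp horner_coef mulr_sumr.
  rewrite -(@nneseries_fin_support _ (fun n => a z * ((G ^+ z)`_n * r ^+ n))
    (size (G ^+ z))).
  - by apply: eq_eseriesr => n _; rewrite mulrA.
  - by move=> n; rewrite mulrA.
  - by move=> n zn; rewrite nth_default // mul0r mulr0.
by move=> n z; rewrite lee_fin.
Qed.

Lemma nneseries_exp (x : R) : 0 <= x ->
  (\sum_(0 <= z <oo) (x ^+ z / z`!%:R)%:E = (expR x)%:E)%E.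
Proof.
move=> x0; rewrite /expR -EFin_lim; last exact: is_cvg_series_exp_coeff.
by congr (limn _); apply/funext => n; rewrite /series /exp_coeff /= -sumEFin.
Qed.

(** Here [a z = h ^ z / z! * exp (- Lambda h)]: the process makes a Poisson
    number of jumps with independent sizes. *)
Lemma gcp_pmf_generating (h r : R) : 0 <= h -> 0 <= r ->
  (\sum_(0 <= n <oo) (gcp_pmf lambda h n * r ^+ n)%:E
   = (expR (- (Lambda - G.[r]) * h))%:E)%E.
Proof.
move=> h0 r0; pose a z := h ^+ z / z`!%:R * expR (- Lambda * h).
have a0 z : 0 <= a z by rewrite !mulr_ge0 ?exprn_ge0 ?invr_ge0 ?expR_ge0.
transitivity (\sum_(0 <= z <oo) (a z * G.[r] ^+ z)%:E)%E.
  rewrite -nneseries_compound //; apply: eq_eseriesr => n _.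
  congr (_ * _)%:E; rewrite -sum_weight_eq; apply: eq_bigr => x _.
  rewrite /a -/Lambda.
  have -> : \prod_(j < k) ((lambda j * h) ^+ x j / (x j)`!%:R)
     = \prod_(j < k) (lambda j ^+ x j / (x j)`!%:R) * h ^+ (\sum_(j < k) x j).
    elim/big_rec3: _ => [|j p q w _ ->]; first by rewrite expr0 mulr1.
    by rewrite exprMn exprD; ring.
  have f0 : (\sum_(j < k) x j)`!%:R != 0 :> R by rewrite pnatr_eq0 -lt0n fact_gt0.
  by field.
transitivity (\sum_(0 <= z <oo) (expR (- Lambda * h))%:E *
    ((h * G.[r]) ^+ z / z`!%:R)%:E)%E.
  by apply: eq_eseriesr => z _; rewrite -EFinM /a exprMn; congr EFin; ring.
rewrite nneseriesZl => [|z _]; last first.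
  by rewrite lee_fin divr_ge0 // exprn_ge0 // mulr_ge0 // jump_polynomial_ge0.
rewrite nneseries_exp ?mulr_ge0 ?jump_polynomial_ge0 // -EFinM -expRD.
by congr (expR _)%:E; ring.
Qed.

Section jump_mass.
Variable b : R.
Hypothesis b01 : 0 < b < 1.
Hypothesis Lambda_gt0 : 0 < Lambda.

(** A solution of [weight x = n] with [n > 0] makes at least one jump, so only
    the coefficients of positive index matter, and for these [(-1) ^ (z + 1)]
    is the sign which makes the weights non-negative. *)
Lemma jump_massE (n : nat) : (0 < n)%N ->
  jump_mass lambda b n
  = \sum_(z < n.+1) (binomial_weight b z * (Lambda `^ b / Lambda ^+ z))
      * (G ^+ z)`_n.
Proof.
move=> n0.
rewrite -(sum_weight_eq lambda n
  (fun z => binomial_weight b z * (Lambda `^ b / Lambda ^+ z))).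
apply: eq_bigr => x /eqP wx; cbv zeta; rewrite -/Lambda -mulrA; congr (_ * _).
have: (0 < \sum_(j < k) x j)%N.
  rewrite lt0n; apply/negP => /eqP s0; move: n0; rewrite -wx /weight.
  rewrite big1 // => j _; apply/eqP; rewrite muln_eq0 /= -leqn0 -[leqRHS]s0.
  by rewrite (bigD1 j) //= leq_addr.
case: (\sum_(j < k) x j)%N => // z _; rewrite /= /alt_binomial.
rewrite powRB ?(gt_eqF Lambda_gt0) ?implybT // powR_mulrn ?ltW // exprS.
have L0 : Lambda != 0 by rewrite gt_eqF.
have Lb0 : Lambda `^ b != 0 by rewrite gt_eqF // powR_gt0.
have Lz0 : Lambda ^+ z.+1 != 0 by rewrite expf_neq0.
by field; rewrite Lz0 Lb0.
Qed.

Lemma jump_mass_ge0 (n : nat) : (0 < n)%N -> 0 <= jump_mass lambda b n.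
Proof.
move=> n0; rewrite jump_massE //; apply: sumr_ge0 => z _.
rewrite !mulr_ge0 ?binomial_weight_ge0 ?coef_jump_polynomialX_ge0 ?powR_ge0 //.
by rewrite invr_ge0 exprn_ge0 // ltW.
Qed.

Lemma jump_mass_generating (r : R) : 0 <= r -> r <= 1 ->
  (\sum_(1 <= n <oo) (jump_mass lambda b n * r ^+ n)%:E
   = (Lambda `^ b - (Lambda - G.[r]) `^ b)%:E)%E.
Proof.
move=> r0 r1; pose a z := binomial_weight b z * (Lambda `^ b / Lambda ^+ z).
have a0 z : 0 <= a z.
  by rewrite !mulr_ge0 ?binomial_weight_ge0 ?powR_ge0 // invr_ge0 exprn_ge0 // ltW.
transitivity (\sum_(0 <= n <oo)
    ((\sum_(z < n.+1) a z * (G ^+ z)`_n) * r ^+ n)%:E)%E.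
  rewrite [RHS]nneseries_recl // => [|n _]; last first.
    rewrite lee_fin mulr_ge0 ?exprn_ge0 // sumr_ge0 // => z _.
    by rewrite mulr_ge0 // coef_jump_polynomialX_ge0.
  rewrite big_ord1 /a /= !mul0r add0e; apply: congr_lim.
  apply/funext => N; apply: eq_big_nat => n /andP[n0 _].
  by rewrite jump_massE.
rewrite nneseries_compound //.
have G0 := jump_polynomial_ge0 r0; have G1 := jump_polynomial_le r0 r1.
transitivity (\sum_(0 <= z <oo) (Lambda `^ b)%:E *
    (binomial_weight b z * (G.[r] / Lambda) ^+ z)%:E)%E.
  apply: eq_eseriesr => z _; rewrite -EFinM /a expr_div_n.
  by congr EFin; ring.
rewrite nneseriesZl => [|z _]; last first.
  by rewrite lee_fin mulr_ge0 ?binomial_weight_ge0 ?exprn_ge0 ?divr_ge0 ?(ltW Lambda_gt0).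
rewrite nneseries_binomial_weight ?divr_ge0 ?ler_pdivrMr ?mul1r
  ?(ltW Lambda_gt0) //.
rewrite -EFinM mulrBr mulr1 -powRM ?(ltW Lambda_gt0) //; last first.
  by rewrite subr_ge0 ler_pdivrMr ?mul1r.
by congr (_ - _ `^ _)%:E; field; rewrite gt_eqF.
Qed.

End jump_mass.
End compound_series.

(** * The Bernstein function and the Lévy measure *)

Section laplace_series.
Context (R : realType).

Definition laplace_series (a : nat -> R) (u : R) : R :=
  limn (pseries a (expR (- u))).

Lemma is_derive_laplace_series (a : nat -> R) (u : R) :
  subexponential a -> 0 < u ->
  is_derive u 1 (laplace_series a) (- laplace_series (fun n => n%:R * a n) u).
Proof.
move=> sa u0; have r1 : `|expR (- u)| < 1.
  by rewrite ger0_norm ?expR_ge0 // -expR0 ltr_expR oppr_lt0.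
have d1 := is_derive_pseries sa r1.
have d2 : is_derive u 1 (fun v : R => expR (- v)) (- expR (- u)).
  have d3 : is_derive u 1 (fun v : R => - v) (- 1) by apply: is_derive_eq.
  have := @is_derive1_comp _ expR (fun v : R => - v) _ _ _
    (is_derive_expR (- u)) d3.
  by rewrite mulrN1.
have := @is_derive1_comp _ (fun y : R => limn (pseries a y))
  (fun v : R => expR (- v)) _ _ _ d1 d2.
by rewrite mulrN mulrC mul_lim_pseries_diffs.
Qed.

Lemma laplace_series_ge0 (a : nat -> R) (u : R) : subexponential a ->
  (forall n, 0 <= a n) -> 0 < u -> 0 <= laplace_series a u.
Proof.
move=> sa a0 u0; have r1 : `|expR (- u)| < 1.
  by rewrite ger0_norm ?expR_ge0 // -expR0 ltr_expR oppr_lt0.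
apply: limr_ge; first exact: cvg_pseries_subexponential.
by near=> n; apply: sumr_ge0 => i _; rewrite mulr_ge0 // exprn_ge0 // expR_ge0.
Unshelve. all: by end_near. Qed.

(** Termwise differentiation of [\sum_n a_n exp (- u n)] multiplies [a_n] by
    [- n], so all derivatives keep alternating signs. *)
Lemma bernstein_laplace_series (g : R -> R) (c : R) (a : nat -> R) :
  subexponential a -> (forall n, 0 <= a n) ->
  (forall u, 0 < u -> 0 <= g u) ->
  (forall u, 0 < u -> g u = c - laplace_series a u) ->
  bernstein_function g.
Proof.
move=> sa a0 g0 gE; split=> //.
pose A m := iter m (fun (b : nat -> R) n => n%:R * b n) a.
have sA m : subexponential (A m).
  by elim: m => //= m; exact: subexponentialM.
have A0 m n : 0 <= A m n by elim: m => //= m IH; rewrite mulr_ge0.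
(* The derivative of order [m] is a constant, null from [m = 1] on, plus a
   series with coefficients [n ^ m * a n] up to the sign [- (-1) ^ m]. *)
pose e m : R := if m is 0 then c else 0.
have step (h : R -> R) m (u : R) : 0 < u ->
    (forall v : R, 0 < v -> h v = e m - (-1) ^+ m * laplace_series (A m) v) ->
    is_derive u 1 h ((-1) ^+ m * laplace_series (A m.+1) u).
  move=> u0 hE.
  apply: (@near_eq_is_derive _ _ _
    (fun v : R => e m - (-1) ^+ m * laplace_series (A m) v)).
    near=> v; rewrite -hE //; near: v; exact: lt_nbhsr.
  have d := is_derive_laplace_series (sA m) u0.
  by apply: is_derive_eq; rewrite /GRing.scale /=; ring.
have gn m (u : R) : 0 < u ->
    (g^`(m))%classic u = e m - (-1) ^+ m * laplace_series (A m) u.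
  elim: m u => [|m IH] u u0; first by rewrite expr0 mul1r; exact: gE.
  rewrite derive1nS derive1E; have d := step _ m u u0 IH.
  by rewrite derive_val exprS /=; ring.
move=> n u u0; have d := step _ n u u0 (gn n); split; first by [].
rewrite derive1nS derive1E derive_val mulrA -exprD addnn -mul2n exprM sqrrN.
by rewrite expr1n expr1n mul1r laplace_series_ge0.
Unshelve. all: by end_near. Qed.

End laplace_series.

Lemma cvg_nneseries_fin (R : realType) (u : nat -> R) (m : nat) (l : R) :
  (forall n, (m <= n)%N -> 0 <= u n) ->
  (\sum_(m <= n <oo) (u n)%:E = l%:E)%E ->
  (\sum_(m <= n < N) u n) @[N --> \oo] --> l.
Proof.
move=> u0 ul; have c : (\sum_(m <= n < N) (u n)%:E)%E @[N --> \oo] --> l%:E.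
  by rewrite -ul; apply: is_cvg_nneseries => n mn _; rewrite lee_fin u0.
have /fine_cvgP[_] := c; apply: cvg_trans; apply: near_eq_cvg.
by near=> N; rewrite /= sumEFin.
Unshelve. all: by end_near. Qed.

Lemma nneseries_fin_cvg (R : realType) (u : nat -> R) (m : nat) (l : R) :
  (\sum_(m <= n < N) u n) @[N --> \oo] --> l ->
  (\sum_(m <= n <oo) (u n)%:E = l%:E)%E.
Proof.
move=> ul; apply/cvg_lim => //.
have -> : (fun N => \sum_(m <= n < N) (u n)%:E)%E
    = EFin \o (fun N => \sum_(m <= n < N) u n).
  by apply/funext => N; rewrite /= sumEFin.
by apply: cvg_EFin => //; near=> N.
Unshelve. all: by end_near. Qed.

Section subordinated_levy.
Context (R : realType) (k : nat) (lambda : 'I_k -> R).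
Hypothesis lambda_gt0 : forall j, 0 < lambda j.
Hypothesis k_gt0 : (0 < k)%N.
Let G := jump_polynomial lambda.
Let Lambda := \sum_(j < k) lambda j.

(** The Laplace exponent [\sum_j lambda_j (1 - exp (- u (j + 1)))] of the
    counting process, with its two parts kept apart. *)
Definition gcp_exponent (u : R) : R := Lambda - G.[expR (- u)].

Lemma total_rate_gt0 : 0 < Lambda.
Proof.
rewrite /Lambda (bigD1 (Ordinal k_gt0)) //= ltr_pwDl // sumr_ge0 // => j _.
exact: ltW.
Qed.

Lemma expRN_itv (u : R) : 0 <= u -> 0 <= expR (- u) <= 1.
Proof. by move=> u0; rewrite expR_ge0 -[leRHS]expR0 ler_expR oppr_le0. Qed.

Lemma gcp_exponent_ge0 (u : R) : 0 <= u -> 0 <= gcp_exponent u.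
Proof.
move=> /expRN_itv/andP[r0 r1].
by rewrite subr_ge0; exact: (jump_polynomial_le lambda_gt0).
Qed.

Section stability_index.
Variable b : R.
Hypothesis b01 : 0 < b < 1.
Let q := jump_mass lambda b.

(** The value at [r = 1], where [G(1) = Lambda]. *)
Lemma sum_jump_mass :
  (\sum_(1 <= n <oo) (q n)%:E = (Lambda `^ b)%:E)%E.
Proof.
have := jump_mass_generating lambda_gt0 b01 total_rate_gt0 ler01 (lexx 1).
rewrite horner_jump_polynomial1 subrr powR0 ?subr0; last first.
  by have /andP[/lt0r_neq0] := b01.
move=> <-; apply: eq_eseriesr => n _.
by rewrite expr1n mulr1.
Qed.

Lemma cvg_jump_mass_laplace (u : R) : 0 <= u ->
  (\sum_(1 <= n < N) q n * (1 - expR (- u * n%:R))) @[N --> \oo]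
    --> gcp_exponent u `^ b.
Proof.
move=> u0; have /andP[r0 r1] := expRN_itv u0.
have q0 n : (1 <= n)%N -> 0 <= q n.
  by move=> n0; exact: (jump_mass_ge0 lambda_gt0 b01 total_rate_gt0).
have c1 := cvg_nneseries_fin q0 sum_jump_mass.
have c2 := cvg_nneseries_fin (fun n n0 => mulr_ge0 (q0 n n0) (exprn_ge0 n r0))
  (jump_mass_generating lambda_gt0 b01 total_rate_gt0 r0 r1).
have -> : gcp_exponent u `^ b
    = Lambda `^ b - (Lambda `^ b - (Lambda - G.[expR (- u)]) `^ b).
  by rewrite /gcp_exponent; ring.
have -> : (fun N => \sum_(1 <= n < N) q n * (1 - expR (- u * n%:R)))
    = (fun N => \sum_(1 <= n < N) q n)
        \- (fun N => \sum_(1 <= n < N) q n * expR (- u) ^+ n).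
  apply/funext => N /=; rewrite -sumrB; apply: eq_bigr => n _.
  by rewrite expRM_natr; ring.
exact: cvgB.
Qed.

Lemma bernstein_gcp_exponent_powR :
  bernstein_function (fun u => gcp_exponent u `^ b).
Proof.
pose a n := if n is 0 then 0 else q n.
have a0 n : 0 <= a n.
  case: n => //= n; exact: (jump_mass_ge0 lambda_gt0 b01 total_rate_gt0).
have q0 n : (1 <= n)%N -> 0 <= q n by case: n => // n _; exact: (a0 n.+1).
have c1 := cvg_nneseries_fin q0 sum_jump_mass.
apply: (@bernstein_laplace_series _ _ (Lambda `^ b) a) => // [|u u0|u u0].
- apply: (@subexponential_bounded _ _ (Lambda `^ b)) => n.
  rewrite ger0_norm //; case: n => [|n] /=; first exact: powR_ge0.
  rewrite -lee_fin -sum_jump_mass.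
  rewrite (nneseries_split 1 n.+1) ?add1n; last by move=> i i0; rewrite lee_fin q0.
  rewrite big_nat_recr //= -[leLHS]add0e -addeA; apply: leeD.
    by rewrite big_nat_cond sume_ge0 // => i /andP[/andP[i0 _] _]; rewrite lee_fin q0.
  rewrite leeDl // nneseries_ge0 // => i i0 _; rewrite lee_fin q0 //.
  exact: leq_trans i0.
- exact: powR_ge0.
- have /andP[r0 r1] := expRN_itv (ltW u0).
  have c2 := cvg_nneseries_fin (fun n n0 => mulr_ge0 (q0 n n0) (exprn_ge0 n r0))
    (jump_mass_generating lambda_gt0 b01 total_rate_gt0 r0 r1).
  suff -> : laplace_series a u = Lambda `^ b - gcp_exponent u `^ b by ring.
  apply/cvg_lim => //; apply: cvg_trans c2; apply: near_eq_cvg.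
  near=> N; have N0 : (0 < N)%N by near: N; exact: nbhs_infty_gt.
  rewrite /pseries /series /= [RHS]big_ltn //= mul0r add0r.
  by apply: eq_big_nat => -[|i].
Unshelve. all: by end_near. Qed.

End stability_index.

(** The absolute values make this a measure for every real [b]; when
    [0 < b < 1] and the rates are positive, the masses are already
    non-negative. *)
Definition subordinated_levy_measure (b : R) : set R -> \bar R :=
  mseries (fun n => mscale (`|jump_mass lambda b n.+1|%:nng)
    (\d_(n.+1%:R : R) : {measure set R -> \bar R})) 0.

HB.instance Definition _ (b : R) := Measure.on (subordinated_levy_measure b).

Section levy_measure.
Variable b : R.
Hypothesis b01 : 0 < b < 1.
Let q := jump_mass lambda b.

Lemma subordinated_levy_measureE (A : set R) :
  subordinated_levy_measure b A
  = (\sum_(1 <= n <oo) (q n)%:E * \d_(n%:R : R) A)%E.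
Proof.
have q0 n : (0 < n)%N -> 0 <= q n.
  by move=> n0; exact: (jump_mass_ge0 lambda_gt0 b01 total_rate_gt0).
rewrite /subordinated_levy_measure /mseries /=.
pose f n := ((`|q n|)%:E * \d_(n%:R : R) A)%E.
transitivity (\sum_(1 <= n <oo) f n)%E.
  rewrite -(nneseries_addn 1) => [|n].
    by apply: eq_eseriesr => n _; rewrite addn1.
  by rewrite /f mule_ge0.
apply: congr_lim; apply/funext => N; apply: eq_big_nat => n /andP[n0 _].
by rewrite /f ger0_norm ?q0.
Qed.

Lemma integral_subordinated_levy_measure (f : R -> R) :
  measurable_fun setT f -> (forall x, 0 <= x -> 0 <= f x) ->
  (\int[subordinated_levy_measure b]_(x in `]0%R, +oo[) (f x)%:E
   = \sum_(1 <= n <oo) (q n * f n%:R)%:E)%E.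
Proof.
move=> mf f0.
have q0 n : (0 < n)%N -> 0 <= q n.
  by move=> n0; exact: (jump_mass_ge0 lambda_gt0 b01 total_rate_gt0).
have mD : measurable (`]0, +oo[%classic : set R) by [].
have mfE : measurable_fun (`]0, +oo[%classic : set R) (EFin \o f).
  by apply: measurable_funTS; exact/measurable_EFinP.
have f0E x : (`]0, +oo[%classic : set R) x -> (0 <= (f x)%:E)%E.
  by rewrite /= in_itv /= andbT => x0; rewrite lee_fin f0 // ltW.
rewrite ge0_integral_measure_series //.
pose g n := (`|q n| * f n%:R)%:E.
transitivity (\sum_(1 <= n <oo) g n)%E.
  rewrite -(nneseries_addn 1) => [|n].
    apply: eq_eseriesr => n _; rewrite addn1 ge0_integral_mscale //.
    rewrite integral_dirac // diracE mem_set ?mul1e //.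
    by rewrite /= in_itv /= ltr0n.
  by rewrite /g lee_fin mulr_ge0 // f0.
apply: congr_lim; apply/funext => N; apply: eq_big_nat => n /andP[n0 _].
by rewrite /g ger0_norm ?q0.
Qed.

Lemma subordinator_levy_measure_subordinated :
  subordinator_levy_measure (subordinated_levy_measure b).
Proof.
have q0 n : (0 < n)%N -> 0 <= q n.
  by move=> n0; exact: (jump_mass_ge0 lambda_gt0 b01 total_rate_gt0).
split.
  rewrite /= subordinated_levy_measureE; apply: eseries0 => n n0 _.
  rewrite diracE memNset ?mule0 //= in_itv /= ltr0n n0; exact.
rewrite integral_subordinated_levy_measure.
- apply: (@le_lt_trans _ _ (Lambda `^ b)%:E); last exact: ltry.
  rewrite -(sum_jump_mass b01); apply: lee_lim.
  + apply: is_cvg_nneseries => n n0 _.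
    by rewrite lee_fin mulr_ge0 ?q0 // le_min ler01 ler0n.
  + by apply: is_cvg_nneseries => n n0 _; rewrite lee_fin q0.
  + near=> N; rewrite big_seq [leRHS]big_seq; apply: lee_sum => n.
    rewrite mem_index_iota => /andP[n0 _].
    by rewrite lee_fin ler_piMr ?q0 // ge_min lexx.
- exact: measurable_minr.
- by move=> x x0; rewrite le_min ler01.
Unshelve. all: by end_near. Qed.

Lemma levy_khintchine_subordinated (u : R) : 0 <= u ->
  (gcp_exponent u `^ b)%:E
  = (\int[subordinated_levy_measure b]_(x in `]0%R, +oo[)
       (1 - expR (- u * x))%:E)%E.
Proof.
move=> u0; rewrite integral_subordinated_levy_measure.
- by rewrite (nneseries_fin_cvg (cvg_jump_mass_laplace b01 u0)).
- apply: measurable_funB => //; apply: measurableT_comp => //.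
- by move=> x x0; rewrite subr_ge0 -[leRHS]expR0 ler_expR mulNr oppr_le0 mulr_ge0.
Qed.

End levy_measure.
End subordinated_levy.

(** * Joint measurability and decoupling *)

Section right_approximation.
Context (R : realType).

(** The first point of the grid of mesh [1 / (m + 1)] strictly above [t >= 0]:
    being strictly above, it tends to [t] from the right. *)
Definition grid_above (m : nat) (t : R) : R :=
  (Num.truncn (m.+1%:R * t)).+1%:R / m.+1%:R.

Lemma grid_above_gt (m : nat) (t : R) : t < grid_above m t.
Proof. by rewrite /grid_above ltr_pdivlMr // mulrC truncnS_gt. Qed.

Lemma cvg_grid_above (t : R) : 0 <= t ->
  grid_above m t @[m --> \oo] --> t.
Proof.
move=> t0; apply: (@squeeze_cvgr _ _ _ _ (fun=> t)
  (fun m => t + m.+1%:R^-1)).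
- near=> m; rewrite (ltW (grid_above_gt _ _)) /= /grid_above.
  rewrite ler_pdivrMr // mulrDl mulVf // -natr1 lerD2r.
  by rewrite [leRHS]mulrC truncn_le mulr_ge0.
- exact: cvg_cst.
- rewrite -[X in _ --> X]addr0; apply: cvgD; first exact: cvg_cst.
  exact: cvg_harmonic.
Unshelve. all: by end_near. Qed.

Lemma cvg_right_grid (f : R -> R) (t : R) : 0 <= t ->
  f s @[s --> t^'+] --> f t -> f (grid_above m t) @[m --> \oo] --> f t.
Proof.
move=> t0 /cvg_at_rightP; apply; split=> [m|]; first exact: grid_above_gt.
exact: cvg_grid_above.
Qed.

(** The process is the limit of the processes read at the next grid time, and
    these are measurable because the grid is countable.  Absolute values
    extend the time axis to the whole line. *)
Lemma measurable_right_continuous_process (d : measure_display)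
    (T : measurableType d) (X : R -> T -> R) :
  (forall t, 0 <= t -> measurable_fun setT (X t)) ->
  (forall w t, 0 <= t -> X s w @[s --> t^'+] --> X t w) ->
  measurable_fun [set: R * T] (fun p : R * T => X `|p.1| p.2).
Proof.
move=> mX rX.
apply: (@measurable_fun_cvg _ _ _ _
  (fun m (p : R * T) => X (grid_above m `|p.1|) p.2)) => [m|p _].
  pose E n : set (R * T) :=
    (fun p : R * T => m.+1%:R * `|p.1|) @^-1` `[n%:R, n.+1%:R[.
  have mE n : measurable (E n).
    have mF : measurable_fun setT (fun p : R * T => m.+1%:R * `|p.1|).
      by apply: measurable_funM => //; apply: measurableT_comp => //.
    by rewrite -[E n]setTI; apply: mF => //; exact: measurable_itv.
  have -> : [set: R * T] = \bigcup_n E n.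
    apply/esym; rewrite -subTset => p _; exists (Num.truncn (m.+1%:R * `|p.1|)) => //.
    by rewrite /E /= in_itv /= truncn_itv // mulr_ge0.
  apply/measurable_fun_bigcup => // n.
  apply: (@eq_measurable_fun _ _ _ _ _ (fun p => X (n.+1%:R / m.+1%:R) p.2)).
    move=> p; rewrite inE /E /= in_itv /= => /truncn_def pn.
    by rewrite /grid_above pn.
  apply: measurable_funTS; apply: measurableT_comp => //.
  by apply: mX; rewrite divr_ge0.
by apply: (@cvg_right_grid (fun s => X s p.2)) => //; exact: rX.
Qed.

End right_approximation.

Section decoupling.
Local Open Scope ereal_scope.

(** Independence makes the law of [(U, V)] the product of the two laws, by
    uniqueness of the product measure; the rest is Fubini. *)
Lemma integral_independent_pair (R : realType) (d d1 d2 : measure_display)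
    (T : measurableType d) (T1 : measurableType d1) (T2 : measurableType d2)
    (P : probability T R) (U : T -> T1) (V : T -> T2) (f : T1 * T2 -> \bar R) :
  measurable_fun setT U -> measurable_fun setT V ->
  (forall A B, measurable A -> measurable B ->
    P (U @^-1` A `&` V @^-1` B) = P (U @^-1` A) * P (V @^-1` B)) ->
  measurable_fun setT f -> (forall p, 0 <= f p) ->
  \int[P]_w f (U w, V w) = \int[P]_w2 \int[P]_w1 f (U w1, V w2).
Proof.
move=> mU mV ind mf f0.
pose U' : {mfun T >-> T1} := mfun_Sub (mem_set mU).
pose V' : {mfun T >-> T2} := mfun_Sub (mem_set mV).
have mUV : measurable_fun setT (fun w => (U w, V w)) by exact: measurable_fun_pair.
transitivity (\int[pushforward P (fun w => (U w, V w))]_p f p).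
  by rewrite ge0_integral_pushforward.
transitivity (\int[distribution P U' \x distribution P V']_p f p).
  apply/esym; apply: eq_measure_integral => A mA _.
  exact: product_measure_unique.
rewrite fubini_tonelli2 // /fubini_G.
rewrite ge0_integral_distribution //.
- apply: eq_integral => w2 _ /=.
  rewrite ge0_integral_distribution //.
  exact: measurableT_comp.
- exact: measurable_fun_fubini_tonelli_G.
- by move=> y; apply: integral_ge0.
Qed.

End decoupling.

Lemma measurable_integral_independent_pair (R : realType) (d d1 d2 : measure_display)
    (T : measurableType d) (T1 : measurableType d1) (T2 : measurableType d2)
    (P : probability T R) (U : T -> T1) (V : T -> T2) (f : T1 * T2 -> \bar R) :
  measurable_fun setT U -> measurable_fun setT V ->
  measurable_fun setT f -> (forall p, 0 <= f p)%E ->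
  measurable_fun setT (fun w2 => \int[P]_w1 f (U w1, V w2))%E.
Proof.
move=> mU mV mf f0.
pose U' : {mfun T >-> T1} := mfun_Sub (mem_set mU).
have -> : (fun w2 => \int[P]_w1 f (U w1, V w2))%E
    = fubini_G (distribution P U') f \o V.
  apply/funext => w2; rewrite /fubini_G /= ge0_integral_distribution //.
  exact: measurableT_comp.
by apply: measurableT_comp mV; exact: measurable_fun_fubini_tonelli_G.
Qed.

(** * Mean of a product of functions of independent variables *)

Section mean_of_product.
Context (R : realType) (d : measure_display) (T : measurableType d).
Context (P : probability T R).

Lemma integral_weighted_indic (I : finType) (C : I -> R) (S : I -> set T) :
  (forall i, 0 <= C i) -> (forall i, measurable (S i)) ->
  (\int[P]_w (\sum_i C i * \1_(S i) w)%:E = (\sum_i C i * fine (P (S i)))%:E)%E.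
Proof.
move=> C0 mS; under eq_integral do rewrite -sumEFin.
rewrite ge0_integral_sum //; last first.
- by move=> i w _; rewrite lee_fin mulr_ge0 // indicE ler0n.
- move=> i; apply/measurable_EFinP; apply: measurable_funM => //.
rewrite -sumEFin; apply: eq_bigr => i _.
under eq_integral do rewrite EFinM.
rewrite ge0_integralZl_EFin //.
- by rewrite integral_indic // setIT EFinM fineK // fin_num_measure.
- exact/measurable_EFinP.
Qed.

Lemma cvg_integral_unit (h : nat -> T -> R) (h' : T -> R) :
  (forall m, measurable_fun setT (h m)) ->
  (forall m w, 0 <= h m w <= 1) -> (forall w, h m w @[m --> \oo] --> h' w) ->
  (\int[P]_w (h m w)%:E)%E @[m --> \oo] --> (\int[P]_w (h' w)%:E)%E.
Proof.
move=> mh h01 hh'; apply: (@dominated_cvg _ _ _ _ _ _ _ _ (cst 1%E)) => //.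
- by move=> m; apply/measurable_EFinP.
- move=> w _; apply: cvg_EFin; first by near=> m.
  exact: hh'.
- exact: finite_measure_integrable_cst.
- move=> m w _ /=; have /andP[h0 h1] := h01 m w.
  by rewrite lee_fin ger0_norm.
Unshelve. all: by end_near. Qed.

Lemma integral_unit_fin_num (h : T -> R) : measurable_fun setT h ->
  (forall w, 0 <= h w <= 1) -> (\int[P]_w (h w)%:E)%E \is a fin_num.
Proof.
move=> mh h01; rewrite ge0_fin_numE; last first.
  by apply: integral_ge0 => w _; rewrite lee_fin; have /andP[] := h01 w.
apply: (@le_lt_trans _ _ (\int[P]_w (cst 1%E w))%E).
  apply: ge0_le_integral => //.
  - by move=> w _; rewrite lee_fin; have /andP[] := h01 w.
  - exact/measurable_EFinP.
  - by move=> w _; rewrite lee_fin; have /andP[] := h01 w.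
by rewrite (integral_cst P measurableT) mul1e -ge0_fin_numE ?fin_num_measure.
Qed.

Context (n : nat) (Y : 'I_n -> T -> R).
Hypothesis mY : forall i, measurable_fun setT (Y i).
Hypothesis indY : mutually_independent P Y.

Lemma measurable_forall_mem (B : 'I_n -> set R) :
  (forall i, measurable (B i)) -> measurable [set w | forall i, B i (Y i w)].
Proof.
move=> mB; have -> : [set w | forall i, B i (Y i w)]
    = \bigcap_(i in [set: 'I_n]) (Y i @^-1` B i).
  by apply/seteqP; split => w /= h i => [_|]; exact: h.
apply: fin_bigcap_measurable; first exact: finite_finset.
by move=> i _; rewrite -[_ @^-1` _]setTI; exact: mY.
Qed.

(** Expanding the product of sums reduces the claim, term by term, to the
    independence of the events [Y i \in A i (f i)]. *)
Lemma integral_prod_step (K : nat) (c : 'I_K -> R) (A : 'I_n -> 'I_K -> set R) :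
  (forall v, 0 <= c v) -> (forall i v, measurable (A i v)) ->
  (\int[P]_w (\prod_(i < n) \sum_(v < K) c v * \1_(A i v) (Y i w))%:E
   = (\prod_(i < n)
        fine (\int[P]_w (\sum_(v < K) c v * \1_(A i v) (Y i w))%:E))%:E)%E.
Proof.
move=> c0 mA.
have mYA i v : measurable (Y i @^-1` A i v).
  by rewrite -[_ @^-1` _]setTI; exact: mY.
have -> : (fun w => (\prod_(i < n) \sum_(v < K) c v * \1_(A i v) (Y i w))%:E)
  = (fun w => (\sum_(f : {ffun 'I_n -> 'I_K}) (\prod_(i < n) c (f i))
      * \1_[set w | forall i, A i (f i) (Y i w)] w)%:E).
  apply/funext => w; congr EFin; rewrite bigA_distr_bigA.
  apply: eq_bigr => f _; rewrite big_split /=; congr (_ * _).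
  have [h|h] := pselect (forall i, A i (f i) (Y i w)).
    by rewrite indicE mem_set // big1 // => i _; rewrite indicE mem_set.
  have [i Ai] : exists i, ~ A i (f i) (Y i w) by exact/existsNP.
  rewrite [RHS]indicE memNset //.
  by rewrite (bigD1 i) //= indicE memNset // mul0r.
rewrite integral_weighted_indic; last 2 first.
- by move=> f; apply: prodr_ge0.
- by move=> f; apply: (measurable_forall_mem (B := fun i => A i (f i))).
congr EFin; rewrite [RHS](eq_bigr (fun i => \sum_(v < K)
    c v * fine (P (Y i @^-1` A i v)))); last first.
  move=> i _; rewrite -[RHS]/(fine (_%:E)); congr fine.
  exact: (integral_weighted_indic c0 (mYA i)).
rewrite bigA_distr_bigA; apply: eq_bigr => f _.
rewrite big_split /=; congr (_ * _).
rewrite (indY (B := fun i => A i (f i))) //.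
rewrite (eq_bigr (fun i => (fine (P (Y i @^-1` A i (f i))))%:E)).
  by rewrite prodEFin.
by move=> i _; rewrite fineK // fin_num_measure.
Qed.

Lemma truncn_sum_indic (N : nat) (x : R) : 0 <= x <= 1 ->
  (Num.truncn (N.+1%:R * x))%:R / N.+1%:R
  = \sum_(v < N.+2) v%:R / N.+1%:R * (Num.truncn (N.+1%:R * x) == v)%:R :> R.
Proof.
move=> /andP[x0 x1]; have t : (Num.truncn (N.+1%:R * x) < N.+2)%N.
  by rewrite ltnS truncn_le_nat (@le_lt_trans _ _ N.+1%:R) ?ler_piMr // ltr_nat.
rewrite (bigD1 (Ordinal t)) //= eqxx mulr1 big1 ?addr0 // => v.
by rewrite -val_eqE eq_sym /= => /negbTE ->; rewrite mulr0.
Qed.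

Lemma cvg_truncn (x : R) : 0 <= x ->
  (Num.truncn (N.+1%:R * x))%:R / N.+1%:R @[N --> \oo] --> x.
Proof.
move=> x0; apply: (@squeeze_cvgr _ _ _ _ (fun N => x - N.+1%:R^-1) (fun=> x)).
- near=> N; have /andP[t0 t1] : (Num.truncn (N.+1%:R * x))%:R <= N.+1%:R * x
     < (Num.truncn (N.+1%:R * x)).+1%:R by rewrite truncn_itv // mulr_ge0.
  rewrite ler_pdivrMr // [_ * N.+1%:R]mulrC t0 andbT ler_pdivlMr //.
  by rewrite mulrBl mulVf // lerBlDr natr1 mulrC ltW.
- rewrite -[X in _ --> X]subr0; apply: cvgB; first exact: cvg_cst.
  exact: cvg_harmonic.
- exact: cvg_cst.
Unshelve. all: by end_near. Qed.

(** Independence is only given on events.  Rounding each [p i] down to a multiple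
    of [1 / (N + 1)] gives finitely many values, and dominated convergence
    removes the rounding. *)
Lemma integral_prod_independent (p : 'I_n -> R -> R) :
  (forall i, measurable_fun setT (p i)) -> (forall i y, 0 <= p i y <= 1) ->
  (\int[P]_w (\prod_(i < n) p i (Y i w))%:E
   = (\prod_(i < n) fine (\int[P]_w (p i (Y i w))%:E))%:E)%E.
Proof.
move=> mp p01.
pose q (N : nat) i y : R := (Num.truncn (N.+1%:R * p i y))%:R / N.+1%:R.
pose A (N : nat) i (v : 'I_N.+2) : set R :=
  [set y | Num.truncn (N.+1%:R * p i y) = v].
have mA N i v : measurable (A N i v).
  have mNp : measurable_fun setT (fun y => N.+1%:R * p i y).
    by apply: measurable_funM.
  have -> : A N i v = setT `&` (fun y => N.+1%:R * p i y) @^-1` `[v%:R, v.+1%:R[.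
    rewrite setTI; apply/seteqP; split => y; rewrite /A /= in_itv /=.
      by move=> <-; rewrite truncn_itv // mulr_ge0 //; have /andP[] := p01 i y.
    exact: truncn_def.
  by apply: mNp => //; exact: measurable_itv.
have qE N i y : q N i y = \sum_(v < N.+2) v%:R / N.+1%:R * \1_(A N i v) y.
  rewrite /q truncn_sum_indic //; apply: eq_bigr => v _; congr (_ * _).
  rewrite indicE; case: eqP => h; first by rewrite mem_set.
  by rewrite memNset.
have q01 N i y : 0 <= q N i y <= 1.
  have /andP[p0 p1] := p01 i y.
  rewrite /q divr_ge0 //= ler_pdivrMr // mul1r.
  apply: (@le_trans _ _ (N.+1%:R * p i y)); last by rewrite ler_piMr.
  by rewrite truncn_le mulr_ge0.
have mq N i : measurable_fun setT (q N i).
  rewrite (funext (qE N i)); apply: measurable_sum => v.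
  by apply: measurable_funM.
have mqY N i : measurable_fun setT (fun w => q N i (Y i w)).
  exact: measurableT_comp.
have qp i y : q N i y @[N --> \oo] --> p i y.
  by apply: cvg_truncn; have /andP[] := p01 i y.
have lhs : (\int[P]_w (\prod_(i < n) q N i (Y i w))%:E)%E @[N --> \oo]
    --> (\int[P]_w (\prod_(i < n) p i (Y i w))%:E)%E.
  apply: cvg_integral_unit => [N|N w|w].
  - by apply: measurable_prod.
  - rewrite prodr_ge0 /= => [|i _]; last by have /andP[] := q01 N i (Y i w).
    by apply: prodr_ile1 => i _.
  - by apply: cvg_big => // z; exact: mul_continuous.
have rhs : (\prod_(i < n) fine (\int[P]_w (q N i (Y i w))%:E))%:E%E @[N --> \oo]
    --> (\prod_(i < n) fine (\int[P]_w (p i (Y i w))%:E))%:E%E.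
  apply: cvg_EFin; first by near=> N.
  suff : \prod_(i < n) fine (\int[P]_w (q N i (Y i w))%:E)%E @[N --> \oo]
      --> \prod_(i < n) fine (\int[P]_w (p i (Y i w))%:E)%E by [].
  apply: cvg_big => [|i _]; first exact: mul_continuous.
  apply: fine_cvg; rewrite fineK; last first.
    by apply: integral_unit_fin_num => //; exact: measurableT_comp.
  exact: (cvg_integral_unit (h := fun N w => q N i (Y i w))
    (h' := fun w => p i (Y i w))).
rewrite -(cvg_lim _ lhs) // -(cvg_lim _ rhs) //; congr (limn _).
apply/funext => N; under eq_integral do under eq_bigr do rewrite qE.
rewrite (integral_prod_step (c := fun v => v%:R / N.+1%:R) (A := A N)) //.
congr EFin; apply: eq_bigr => i _; congr fine; apply: eq_integral => w _.
by rewrite qE.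
Unshelve. all: by end_near. Qed.

End mean_of_product.

(** * The counting process *)

Section process_space.
Context (R : realType) (d : measure_display) (T : measurableType d).

(** The sample space with the sigma-algebra generated by a process.  Two such
    copies of the same space turn the independence of two processes into a
    statement about a pair of random elements. *)
Definition process_space (X : R -> T -> R) :=
  g_sigma_algebraType
    (\bigcup_(t in `[0, +oo[) preimage_set_system [set: T] (X t) measurable).

Lemma measurable_process_space (X : R -> T -> R) (t : R) : 0 <= t ->
  measurable_fun [set: process_space X] (X t).
Proof.
move=> t0 _ B mB; apply: sub_sigma_algebra; exists t.
  by rewrite /= in_itv /= t0.
by exists B.
Qed.

Lemma measurable_to_process_space (X : R -> T -> R) :
  (forall t, 0 <= t -> measurable_fun [set: T] (X t)) ->
  measurable_fun [set: T] (id : T -> process_space X).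
Proof.
move=> mX _ A mA; rewrite setTI preimage_id.
move: A mA; apply: smallest_sub; first exact: sigma_algebra_measurable.
move=> A [t /=]; rewrite in_itv /= andbT => t0 [B mB <-]; exact: mX.
Qed.

End process_space.

Section counting_process.
Context (R : realType) (d : measure_display) (T : measurableType d).
Context (P : probability T R) (k : nat) (lambda : 'I_k -> R).
Context (M : R -> T -> nat).
Hypothesis lambda_gt0 : forall j, 0 < lambda j.
Hypothesis gcpM : generalized_counting_process P lambda M.
Let N := nat_process M.
Let levyN : levy_process P N := gcpM.1.
Let mN t : 0 <= t -> measurable_fun setT (N t) := levy_measurable levyN (t := t).

Lemma integral_gcp_laplace (u h : R) : 0 <= u -> 0 <= h ->
  (\int[P]_w (expR (- u * N h w))%:E
   = (expR (- gcp_exponent lambda u * h))%:E)%E.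
Proof.
move=> u0 h0; pose F n := [set w | M h w = n].
have mF n : measurable (F n).
  have -> : F n = setT `&` N h @^-1` [set n%:R].
    rewrite setTI; apply/seteqP; split=> w; rewrite /F /N /nat_process /=.
      by move=> ->.
    by move=> /eqP; rewrite eqr_nat => /eqP.
  exact: mN.
have UF : \bigcup_n F n = setT by rewrite -subTset => w _; exists (M h w).
rewrite -UF ge0_integral_bigcup //.
- transitivity (\sum_(0 <= n <oo)
      (gcp_pmf lambda h n * expR (- u) ^+ n)%:E)%E; last first.
    exact: (gcp_pmf_generating lambda_gt0 h0 (expR_ge0 (- u))).
  apply: eq_eseriesr => n _.
  rewrite (eq_integral (cst (expR (- u * n%:R))%:E)); last first.
    by move=> w; rewrite inE /F /N /nat_process /= => ->.
  rewrite integral_cst // expRM_natr EFinM muleC; congr (_ * _)%E.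
  exact: gcpM.2.
- rewrite UF; apply/measurable_EFinP; apply: measurableT_comp => //.
  by apply: measurable_funM => //; exact: mN.
- apply/trivIsetP => i j _ _ /eqP ij; rewrite -subset0 => w [/= Mi Mj].
  by apply: ij; rewrite -Mi.
Qed.

(** By stationarity the increment has the law of [M(t - s) - M(0)], and [M(0)]
    vanishes almost surely. *)
Lemma integral_gcp_increment (f : R -> \bar R) (s t : R) :
  measurable_fun setT f -> (forall x, 0 <= f x)%E -> 0 <= s -> s <= t ->
  (\int[P]_w f (N t w - N s w)%R = \int[P]_w f (N (t - s)%R w))%E.
Proof.
move=> mf f0 s0 st; have t0 := le_trans s0 st.
have ts0 : 0 <= t - s by rewrite subr_ge0.
have mD a b : 0 <= a -> 0 <= b -> measurable_fun setT (fun w => N a w - N b w).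
  by move=> a0 b0; apply: measurable_funB; exact: mN.
transitivity (\int[P]_w f (N (t - s)%R w - N 0%R w)%R)%E.
  transitivity (\int[pushforward P (fun w => (N t w - N s w)%R)]_x f x)%E.
    by rewrite ge0_integral_pushforward //; exact: mD.
  transitivity (\int[pushforward P (fun w => (N (t - s)%R w - N 0%R w)%R)]_x f x)%E.
    apply: eq_measure_integral; [exact: mD|exact: mD|] => ? ? A mA _.
    exact: (levy_stationary levyN).
  by rewrite ge0_integral_pushforward //; exact: mD.
apply: ae_eq_integral => //.
- by apply: measurableT_comp => //; exact: mD.
- by apply: measurableT_comp => //; exact: mN.
- by apply: filterS (levy_start levyN) => w N0 _; rewrite N0 subr0.
Qed.

Lemma integral_gcp_increment_laplace (u s t : R) : 0 <= u -> 0 <= s -> s <= t ->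
  (\int[P]_w (expR (- u * (N t w - N s w)))%:E
   = (expR (- gcp_exponent lambda u * (t - s)))%:E)%E.
Proof.
move=> u0 s0 st.
rewrite (@integral_gcp_increment (fun x => (expR (- u * x))%:E)) //.
- by rewrite integral_gcp_laplace // subr_ge0.
- by apply/measurable_EFinP; apply: measurableT_comp.
Qed.

(** An increment has the law of [M(t - s) >= 0], so the process is almost surely
    monotone along the countably many grid times; right continuity extends
    this to all times. *)
Lemma gcp_nondecreasing :
  {ae P, forall w, forall s t : R, 0 <= s -> s <= t -> (M s w <= M t w)%N}.
Proof.
have inc s t : 0 <= s -> s <= t -> {ae P, forall w, N s w <= N t w}.
  move=> s0 st; have t0 := le_trans s0 st.
  have st0 : 0 <= t - s by rewrite subr_ge0.
  pose B : set R := `]-oo, 0[%classic.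
  have mB : measurable B by exact: measurable_itv.
  have mD a b : 0 <= a -> 0 <= b ->
      measurable [set w | B (N a w - N b w)].
    move=> a0 b0; rewrite -[X in measurable X]setTI.
    by apply: (@measurable_funB _ _ _ _ (N a) (N b)); [exact: mN|exact: mN|..].
  exists [set w | B (N t w - N s w)]; split; first exact: mD.
    rewrite (levy_stationary levyN) //.
    have [Z [mZ Z0 sZ]] := levy_start levyN.
    apply: (subset_measure0 _ mZ _ Z0); first exact: mD.
    move=> w /= Bw; apply: sZ => /= N0; move: Bw.
    by rewrite /B /= in_itv /= N0 subr0 ltNge ler0n.
  move=> w /= /negP; rewrite -ltNge /B /= in_itv /= subr_lt0.
  by [].
have grid : {ae P, forall w, forall m i j : nat,
    N (i%:R / m.+1%:R) w <= N ((i + j)%:R / m.+1%:R) w}.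
  apply: ae_foralln => m; apply: ae_foralln => i; apply: ae_foralln => j.
  by apply: inc; rewrite ?divr_ge0 // ler_pM2r ?invr_gt0 // ler_nat leq_addr.
apply: filterS grid => w Nw s t s0 st; have t0 := le_trans s0 st.
rewrite -(ler_nat R); have rN := (levy_cadlag levyN w).1.
apply: (ler_cvg_to (cvg_right_grid s0 (rN s s0)) (cvg_right_grid t0 (rN t t0))).
near=> m; rewrite /grid_above.
set a := (Num.truncn (_ * s)).+1; set b := (Num.truncn (_ * t)).+1.
have ab : (a <= b)%N by rewrite ltnS le_truncn // ler_wpM2l.
by rewrite -(subnKC ab); exact: Nw.
Unshelve. all: by end_near. Qed.

End counting_process.

(** * The time-changed process *)

Section time_change.
Context (R : realType) (d : measure_display) (T : measurableType d).
Context (P : probability T R) (k : nat) (lambda : 'I_k -> R).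
Context (M : R -> T -> nat) (H : R -> T -> R).
Hypothesis lambda_gt0 : forall j, 0 < lambda j.
Hypothesis gcpM : generalized_counting_process P lambda M.
Hypothesis mH : forall t, 0 <= t -> measurable_fun [set: T] (H t).
Hypothesis H_ge0 : forall t w, 0 <= t -> 0 <= H t w.
Hypothesis H_nondecreasing :
  {ae P, forall w, forall s t : R, 0 <= s -> s <= t -> H s w <= H t w}.
Hypothesis indepH : independent_increments P H.
Hypothesis indepMH : independent_processes P (nat_process M) H.
Let N := nat_process M.
Let X := nat_process (subordinated M H).
Let levyN : levy_process P N := gcpM.1.
Let mN t : 0 <= t -> measurable_fun setT (N t) := levy_measurable levyN (t := t).
Let T1 := process_space N.
Let T2 := process_space H.
Let idN : measurable_fun [set: T] (id : T -> T1).
Proof. exact: measurable_to_process_space. Qed.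
Let idH : measurable_fun [set: T] (id : T -> T2).
Proof. exact: measurable_to_process_space. Qed.

(** The first coordinate drives the counting process, the second its clock. *)
Lemma measurable_time_change (t : R) : 0 <= t ->
  measurable_fun [set: T1 * T2] (fun p : T1 * T2 => N (H t p.2) p.1).
Proof.
move=> t0.
have -> : (fun p : T1 * T2 => N (H t p.2) p.1)
   = (fun q : R * T1 => N `|q.1| q.2) \o (fun p : T1 * T2 => (H t p.2, p.1)).
  by apply/funext => p /=; rewrite ger0_norm // H_ge0.
apply: measurableT_comp.
  apply: measurable_right_continuous_process => [s s0|w s s0].
    exact: measurable_process_space.
  exact: (levy_cadlag levyN w).1.
apply: measurable_fun_pair => //.
by apply: measurableT_comp => //; exact: measurable_process_space.
Qed.

Lemma measurable_subordinated (t : R) : 0 <= t -> measurable_fun [set: T] (X t).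
Proof.
move=> t0; rewrite -[X t]/((fun p : T1 * T2 => N (H t p.2) p.1)
  \o (fun w : T => (w : T1, w : T2))).
apply: measurableT_comp; first exact: measurable_time_change.
exact: measurable_fun_pair.
Qed.

Lemma integral_time_change (f : T1 * T2 -> \bar R) :
  measurable_fun setT f -> (forall p, 0 <= f p)%E ->
  (\int[P]_w f (w, w) = \int[P]_w2 \int[P]_w1 f (w1, w2))%E.
Proof.
move=> mf f0; exact: (@integral_independent_pair _ _ _ _ _ _ _ _
  (id : T -> T1) (id : T -> T2)).
Qed.

Lemma measurable_inner_integral (f : T1 * T2 -> \bar R) :
  measurable_fun setT f -> (forall p, 0 <= f p)%E ->
  measurable_fun [set: T] (fun w2 => \int[P]_w1 f (w1, w2))%E.
Proof.
move=> mf f0; exact: (@measurable_integral_independent_pair _ _ _ _ _ _ _ _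
  (id : T -> T1) (id : T -> T2)).
Qed.

(** The law of [M(h) - M(0)] evaluated on [B], extended evenly to negative [h]. *)
Definition increment_law (B : set R) (h : R) : R :=
  fine (P [set w | B (N `|h| w - N 0 w)]).

Lemma measurable_increment (B : set R) (s t : R) : measurable B ->
  0 <= s -> 0 <= t -> measurable [set w | B (N t w - N s w)].
Proof.
move=> mB s0 t0; rewrite -[X in measurable X]setTI.
by apply: (@measurable_funB _ _ _ _ (N t) (N s)) => //; exact: mN.
Qed.

Lemma increment_law01 (B : set R) (h : R) : measurable B ->
  0 <= increment_law B h <= 1.
Proof.
move=> mB; have mA := measurable_increment mB (lexx 0) (normr_ge0 h).
rewrite fine_ge0 // -lee_fin fineK ?fin_num_measure //.
exact: probability_le1.
Qed.

Lemma increment_lawE (B : set R) (s t : R) : measurable B -> 0 <= s -> s <= t ->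
  P [set w | B (N t w - N s w)] = (increment_law B (t - s))%:E.
Proof.
move=> mB s0 st; have st0 : 0 <= t - s by rewrite subr_ge0.
rewrite (levy_stationary levyN) // /increment_law ger0_norm //.
by rewrite fineK // fin_num_measure //; exact: measurable_increment.
Qed.

Lemma measurable_increment_law (B : set R) : measurable B ->
  measurable_fun setT (increment_law B).
Proof.
move=> mB; pose D (q : R * T) := N `|q.1| q.2 - N 0 q.2.
have mD : measurable_fun setT D.
  apply: measurable_funB.
    apply: measurable_right_continuous_process => // w s s0.
    exact: (levy_cadlag levyN w).1.
  by apply: measurableT_comp => //; exact: mN.
have mS : measurable (D @^-1` B) by rewrite -[_ @^-1` _]setTI; exact: mD.
have -> : increment_law B = fine \o (P \o xsection (D @^-1` B)).
  apply/funext => h; rewrite /increment_law /=; congr (fine (P _)).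
  by apply/seteqP; split => w; rewrite /xsection /= inE.
by apply: measurableT_comp; last exact: measurable_fun_xsection.
Qed.

Section increments.
Variables (n : nat) (t : nat -> R).
Hypothesis t0 : 0 <= t 0.
Hypothesis t_nondecreasing : forall i j, (i <= j)%N -> t i <= t j.

Let t_ge0 i : 0 <= t i.
Proof. by apply: le_trans (t_nondecreasing (leq0n i)). Qed.

Let H_times : {ae P, forall w, forall i j, (i <= j)%N -> H (t i) w <= H (t j) w}.
Proof.
by apply: filterS H_nondecreasing => w Hw i j ij; apply: Hw => //;
  exact: t_nondecreasing.
Qed.

(** Once the clock is frozen at [w2], the increments of [M] are taken between the
    fixed times [H(t_i)(w2)], which are almost surely ordered. *)
Lemma joint_increments_law (B : 'I_n -> set R) :
  (forall i, measurable (B i)) ->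
  (P [set w | forall i : 'I_n, B i (X (t i.+1) w - X (t i) w)%R]
   = \int[P]_w (\prod_(i < n)
       increment_law (B i) (H (t i.+1) w - H (t i) w))%:E)%E.
Proof.
move=> mB.
pose D (i : 'I_n) (p : T1 * T2) := N (H (t i.+1) p.2) p.1 - N (H (t i) p.2) p.1.
have mD i : measurable_fun setT (D i).
  by apply: measurable_funB; exact: measurable_time_change.
pose S : set (T1 * T2) := [set p | forall i, B i (D i p)].
have mS : measurable S by exact: measurable_forall_mem.
have mX : measurable [set w | forall i : 'I_n, B i (X (t i.+1) w - X (t i) w)].
  apply: (measurable_forall_mem
    (Y := fun (i : 'I_n) w => X (t i.+1) w - X (t i) w)) => // i.
  by apply: measurable_funB; exact: measurable_subordinated.
have mf : measurable_fun setT (fun p => (\1_S p)%:E : \bar R).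
  by apply/measurable_EFinP; exact: measurable_indic.
have f0 p : (0 <= (\1_S p)%:E :> \bar R)%E by rewrite lee_fin indicE ler0n.
have PE A : measurable A -> P A = (\int[P]_w (\1_A w)%:E)%E.
  by move=> mA; rewrite integral_indic // setIT.
transitivity (\int[P]_w ((\1_S ((w : T1), (w : T2)))%:E))%E.
  by rewrite (PE _ mX).
transitivity (\int[P]_w2 \int[P]_w1 (\1_S ((w1 : T1), (w2 : T2)))%:E)%E.
  exact: (integral_time_change mf f0).
apply: ae_eq_integral => //.
- exact: (measurable_inner_integral mf f0).
- apply/measurable_EFinP; apply: measurable_prod => i _.
  apply: measurableT_comp; first exact: measurable_increment_law.
  by apply: measurable_funB; exact: mH.
- apply: filterS H_times => w2 Hw _.
  transitivity (P [set w1 | forall i : 'I_n,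
      B i (N (H (t i.+1) w2) w1 - N (H (t i) w2) w1)]).
    rewrite PE //.
    apply: (measurable_forall_mem (Y := fun (i : 'I_n) w1 =>
      N (H (t i.+1) w2) w1 - N (H (t i) w2) w1)) => // i.
    by apply: measurable_funB; apply: mN; exact: H_ge0.
  have := levy_independent levyN (n := n) (t := fun i => H (t i) w2).
  move=> /(_ (H_ge0 _ t0) Hw) /(_ B mB) ->.
  rewrite -prodEFin; apply: eq_bigr => i _.
  by rewrite increment_lawE // ?H_ge0 // Hw.
Qed.

End increments.

(** One increment is the case of a sequence of times that is constant after its
    first step. *)
Lemma increment_law_subordinated (B : set R) (s t : R) :
  measurable B -> 0 <= s -> s <= t ->
  (P [set w | B (X t w - X s w)%R]
   = \int[P]_w (increment_law B (H t w - H s w))%:E)%E.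
Proof.
move=> mB s0 st; pose r i := if i is 0 then s else t.
have rnd i j : (i <= j)%N -> r i <= r j by case: i j => [|i] [|j].
transitivity (P [set w | forall i : 'I_1, B (X (r i.+1) w - X (r i) w)%R]).
  congr (P _); apply/seteqP; split => w /= h => [i|]; last exact: (h ord0).
  by rewrite (ord1 i).
rewrite (joint_increments_law (n := 1) (t := r) s0 rnd (B := fun=> B)) //.
by apply: eq_integral => w _; rewrite big_ord1.
Qed.

Lemma subordinated_independent_increments : independent_increments P X.
Proof.
move=> n t t0 tnd B mB.
have t_ge0 i : 0 <= t i by apply: le_trans (tnd _ _ (leq0n i)).
have mD (i : 'I_n) : measurable_fun setT (fun w => H (t i.+1) w - H (t i) w).
  by apply: measurable_funB; exact: mH.
rewrite (joint_increments_law t0 tnd) //.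
rewrite (integral_prod_independent mD (indepH t0 tnd)
  (p := fun i => increment_law (B i))); last 2 first.
- by move=> i; exact: measurable_increment_law.
- by move=> i y; exact: increment_law01.
rewrite -prodEFin; apply: eq_bigr => i _.
rewrite [RHS]increment_law_subordinated ?tnd // fineK //.
apply: integral_unit_fin_num => [|w]; last exact: increment_law01.
by apply: measurableT_comp; first exact: measurable_increment_law.
Qed.

Lemma subordinated_laplace (u s t : R) : 0 <= u -> 0 <= s -> s <= t ->
  (\int[P]_w (expR (- u * (X t w - X s w)))%:E
   = \int[P]_w (expR (- gcp_exponent lambda u * (H t w - H s w)))%:E)%E.
Proof.
move=> u0 s0 st; have t0 := le_trans s0 st.
pose f (p : T1 * T2) : \bar R :=
  (expR (- u * (N (H t p.2) p.1 - N (H s p.2) p.1)))%:E.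
have mf : measurable_fun setT f.
  apply/measurable_EFinP; apply: measurableT_comp => //.
  apply: measurable_funM => //.
  by apply: measurable_funB; exact: measurable_time_change.
have f0 p : (0 <= f p)%E by rewrite lee_fin expR_ge0.
transitivity (\int[P]_w2 \int[P]_w1 f ((w1 : T1), (w2 : T2)))%E.
  exact: (integral_time_change mf f0).
apply: ae_eq_integral => //.
- exact: (measurable_inner_integral mf f0).
- apply/measurable_EFinP; apply: measurableT_comp => //.
  by apply: measurable_funM => //; apply: measurable_funB; exact: mH.
- apply: filterS H_nondecreasing => w2 Hw _ /=.
  exact: (integral_gcp_increment_laplace lambda_gt0 gcpM u0 (H_ge0 w2 s0)
    (Hw s t s0 st)).
Qed.

End time_change.

(** * The subordination theorem *)

Theorem mainTheorem7 (R : realType) (d : measure_display)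
    (T : measurableType d) (P : probability T R)
    (k : nat) (lambda : 'I_k -> R) (beta : R -> R)
    (M : R -> T -> nat) (H : R -> T -> R)
    (k_gt0 : (0 < k)%N)
    (lambda_gt0 : forall j, 0 < lambda j)
    (gcpM : generalized_counting_process P lambda M)
    (multistableH : multistable_subordinator P beta H)
    (indepMH : independent_processes P (nat_process M) H) :
  exists (nu : R -> {measure set R -> \bar R}) (f : R -> R -> R),
    [/\ forall (t : R) (A : set R), 0 <= t -> measurable A ->
          nu t A = (\sum_(1 <= n <oo)
                      (jump_mass lambda (beta t) n)%:E
                        * \d_(n%:R : R) A)%E,
        forall u t : R, 0 <= u -> 0 <= t ->
          (\sum_(1 <= n < N) jump_mass lambda (beta t) n
              * (1 - expR (- u * n%:R))) @[N --> \oo] --> f u t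
      & inhomogeneous_subordinator P (nat_process (subordinated M H)) nu f].
Proof.
have [beta01 mbeta [nuH [nuHE subH]]] := multistableH.
exists (fun t => subordinated_levy_measure lambda (beta t)).
exists (fun u t => gcp_exponent lambda u `^ beta t); split.
- move=> t A t0 mA.
  exact: (subordinated_levy_measureE lambda_gt0 k_gt0 (beta01 t t0)).
- move=> u t u0 t0.
  exact: (cvg_jump_mass_laplace lambda_gt0 k_gt0 (beta01 t t0)).
have mH := subord_measurable subH.
have H_ge0 := subord_ge0 subH.
have H_nd := subord_nondecreasing subH.
have H_ind := subord_independent subH.
split.
- move=> t t0; exact: (measurable_subordinated gcpM mH H_ge0).
- by move=> t w t0; rewrite ler0n.
- apply: filterS2 (subord_start subH) (levy_start gcpM.1) => w.
  by rewrite /nat_process /subordinated => ->.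
- apply: filterS2 H_nd (gcp_nondecreasing gcpM) => w Hw Mw s t s0 st.
  rewrite ler_nat; apply: Mw; last exact: Hw.
  exact: H_ge0.
- exact: (subordinated_independent_increments gcpM mH H_ge0 H_nd H_ind indepMH).
- move=> t t0.
  exact: (subordinator_levy_measure_subordinated lambda_gt0 k_gt0 (beta01 t t0)).
- move=> t t0.
  exact: (bernstein_gcp_exponent_powR lambda_gt0 k_gt0 (beta01 t t0)).
- move=> u t u0 t0.
  exact: (levy_khintchine_subordinated lambda_gt0 k_gt0 (beta01 t t0)).
- move=> u t u0 t0.
  exact: (subord_locally_integrable subH (gcp_exponent_ge0 lambda_gt0 u0) t0).
- move=> u s t u0 s0 st.
  rewrite -(subord_laplace subH (gcp_exponent_ge0 lambda_gt0 u0) s0 st) unlock.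
  exact: (subordinated_laplace lambda_gt0 gcpM mH H_ge0 H_nd indepMH u0 s0 st).
Qed.
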